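(* Let $\mathsf w$ be a doubling weight on $\mathbb V_0^{d+1}$, and let $\psi_{(z,r),j}$, $(z,r)\in\Xi_j$, $j=0,1,2,\dots$, be the associated frame elements defined in the context. If $f\in L^2(\mathbb V_0^{d+1},\mathsf w)$, then $$f=\sum_{j=0}^\infty\sum_{(z,r)\in\Xi_j}\langle f,\psi_{(z,r),j}\rangle_{\mathsf w}\,\psi_{(z,r),j}\qquad\text{in } L^2(\mathbb V_0^{d+1},\mathsf w)$$ and $$\|f\|_{2,\mathsf w}=\Big(\sum_{j=0}^\infty\sum_{(z,r)\in\Xi_j}|\langle f,\psi_{(z,r),j}\rangle_{\mathsf w}|^2\Big)^{1/2}.$$
   Context: Here $d\ge2$. The conic surface is $\mathbb V_0^{d+1}=\{(x,t):\|x\|=t,\ x\in\mathbb R^d,\ 0\le t\le1\}$ with surface measure $\mathrm d\sigma(x,t)=t^{d-1}\,\mathrm d\sigma_{\mathbb S}(\xi)\,\mathrm dt$ for $x=t\xi$, $\xi\in\mathbb S^{d-1}$, $\sigma_{\mathbb S}$ the surface measure of the unit sphere $\mathbb S^{d-1}$. Its distance is $\mathsf d_{\mathbb V_0}((x,t),(y,s))=\arccos\Big(\sqrt{\tfrac{\langle x,y\rangle+ts}{2}}+\sqrt{1-t}\sqrt{1-s}\Big)$, and $\mathsf c((x,t),r)=\{(y,s)\in\mathbb V_0^{d+1}:\mathsf d_{\mathbb V_0}((x,t),(y,s))\le r\}$. A weight is a nonnegative integrable function $\mathsf w$ on $\mathbb V_0^{d+1}$ and $\mathsf w(E)=\int_E\mathsf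 w\,\mathrm d\sigma$; it is a doubling weight if there is $L$ with $\mathsf w(\mathsf c((x,t),2r))\le L\,\mathsf w(\mathsf c((x,t),r))$ for all $(x,t)$ and $r>0$. $\Pi_n(\mathbb V_0^{d+1})$ is the space of polynomials of degree at most $n$ restricted to $\mathbb V_0^{d+1}$; $\langle f,g\rangle_{\mathsf w}=\int fg\,\mathsf w\,\mathrm d\sigma$ with norm $\|\cdot\|_{2,\mathsf w}$. $\mathsf P_k(\mathsf w;\cdot,\cdot)$ is the reproducing kernel, for $\langle\cdot,\cdot\rangle_{\mathsf w}$, of the space of polynomials in $\Pi_k(\mathbb V_0^{d+1})$ orthogonal to $\Pi_{k-1}(\mathbb V_0^{d+1})$. A discrete set $\Xi\subset\mathbb V_0^{d+1}$ is $\varepsilon$-separated if $\mathsf d_{\mathbb V_0}(p,q)\ge\varepsilon$ for all distinct $p,q\in\Xi$; it is maximal $\varepsilon$-separated if in addition $1\le\sum_{q\in\Xi}\chi_{\mathsf c(q,\varepsilon)}(p)\le c_d$ for all $p\in\mathbb V_0^{d+1}$, with a fixed constant $c_d>1$ independent of $\varepsilon$, where $\chi_E$ is the characteristic function of $E$. Frame elements. Fix a nonnegative $\widehat a\in C^\infty(\mathbb R)$ with $\operatorname{supp}\widehat a\subset[1/2,2]$, $\widehat a(t)\ge\rho>0$ for $t\in[3/5,5/3]$ and $[\widehat a(t)]^2+[\widehat a(2t)]^2=1$ for $t\in[1/2,1]$, and put $\mathsf L_n(\mathsf w;\cdot,\cdot)=\sum_{k\ge0}\widehat a(k/n)\mathsf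 P_k(\mathsf w;\cdot,\cdot)$. For $j=0,1,2,\dots$ let $\Xi_j$ be a maximal $\frac{\delta}{2^j}$-separated subset of $\mathbb V_0^{d+1}$, where $\delta>0$ is chosen (small enough) so that there are numbers $\lambda_{(z,r),j}>0$ with $\int_{\mathbb V_0^{d+1}}f\,\mathsf w\,\mathrm d\sigma=\sum_{(z,r)\in\Xi_j}\lambda_{(z,r),j}f(z,r)$ for all $f\in\Pi_{2^j}(\mathbb V_0^{d+1})$ and with $\lambda_{(z,r),j}$ bounded above and below by positive constant multiples of $\mathsf w(\mathsf c((z,r),2^{-j}))$; fix such $\lambda_{(z,r),j}$. Put $F_0=1$, $F_j(\mathsf w;\cdot,\cdot)=\mathsf L_{2^{j-1}}(\mathsf w;\cdot,\cdot)$ for $j\ge1$, and $\psi_{(z,r),j}(x,t)=\sqrt{\lambda_{(z,r),j}}\,F_j(\mathsf w;(x,t),(z,r))$ for $(z,r)\in\Xi_j$, $j\ge0$.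
   Formalization: F_0 = 1 is replaced by F_0 = 1/w(V_0), equal to 1 when w has total mass 1 (with F_0 = 1 the identity fails for f = 1 otherwise), and the quadrature is assumed exact on Π_{2^{j+1}} instead of Π_{2^j}, since exactness on Π_{2^j} alone does not suffice. *)

(* Defs.v *)
From HB Require Import structures.
From mathcomp Require Import all_boot all_order all_algebra.
From mathcomp Require mpoly.
Import (canonicals, coercions) mpoly.
From mathcomp Require Import all_classical all_reals all_analysis.
From mathcomp Require Import measurable_realfun.

Set Implicit Arguments.
Unset Strict Implicit.
Unset Printing Implicit Defensive.

Import Order.TTheory GRing.Theory Num.Theory.
Import numFieldNormedType.Exports.

Local Open Scope classical_set_scope.
Local Open Scope ring_scope.

(** Vectors of R^d are [d.-tuple R], whose sigma-algebra (generated by the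
    coordinates) is the Borel one. *)

Section Euclidean.
Context {R : realType}.

Definition tdot d (x y : d.-tuple R) : R := \sum_(i < d) tnth x i * tnth y i.

Definition tnorm d (x : d.-tuple R) : R := Num.sqrt (tdot x x).

Definition tscale d (c : R) (x : d.-tuple R) : d.-tuple R :=
  [tuple c * tnth x i | i < d].

Lemma measurable_tdotxx d : measurable_fun [set: d.-tuple R] (fun x => tdot x x).
Proof.
by apply: measurable_sum => i; apply: measurable_funM; exact: measurable_tnth.
Qed.

Lemma measurable_tnorm d : measurable_fun [set: d.-tuple R] (@tnorm d).
Proof.
rewrite [X in measurable_fun _ X](_ : _ = Num.sqrt \o (fun x => tdot x x))//.
apply: measurableT_comp; last exact: measurable_tdotxx.
by apply: continuous_measurable_fun; exact: sqrt_continuous.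
Qed.

Lemma measurable_tscale d0 (T : measurableType d0) d (c : T -> R)
    (f : T -> d.-tuple R) :
  measurable_fun [set: T] c -> measurable_fun [set: T] f ->
  measurable_fun [set: T] (fun x => tscale (c x) (f x)).
Proof.
move=> mc mf; apply/measurable_fun_tnthP => i.
rewrite [X in measurable_fun _ X](_ : _ = fun x => c x * tnth (f x) i).
  apply: measurable_funM => //.
  by apply: (@measurableT_comp _ _ _ _ _ _ (fun x => tnth x i)) => //;
    exact: measurable_tnth.
by apply/funext => x /=; rewrite tnth_mktuple.
Qed.

Lemma measurable_inv : measurable_fun [set: R] (@GRing.inv R).
Proof.
rewrite -(setvU [set 0 : R]); apply/measurable_funU => //.
  exact: measurableC.
split; last exact: measurable_fun_set1.
apply: open_continuous_measurable_fun.
  by rewrite openC; exact: closed_eq.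
by move=> x /set_mem /= /eqP x0; exact: inv_continuous.
Qed.

End Euclidean.

Section Lebesgue.
Context {R : realType}.

Definition tcons n (p : R * n.-tuple R) : n.+1.-tuple R :=
  [tuple of p.1 :: p.2].

Lemma measurable_tcons n : measurable_fun [set: R * n.-tuple R] (@tcons n).
Proof. exact: measurable_cons. Qed.

Section step.
Variables (n : nat) (mu : {sigma_finite_measure set (n.-tuple R) -> \bar R}).

Let m : set (n.+1.-tuple R) -> \bar R :=
  pushforward (@lebesgue_measure R \x mu)%E (@tcons n).

Let mtcons : measurable_fun [set: R * n.-tuple R] (@tcons n).
Proof. exact: measurable_tcons. Qed.

Let m0 : m set0 = 0%E. Proof. exact: measure0. Qed.

Let m_ge0 A : (0 <= m A)%E. Proof. exact: measure_ge0. Qed.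

Let m_sigma_additive : semi_sigma_additive m.
Proof. exact: measure_semi_sigma_additive. Qed.

HB.instance Definition _ := isMeasure.Build _ _ _ m m0 m_ge0 m_sigma_additive.

Let m_sigma_finite : sigma_finite setT m.
Proof.
have /sigma_finiteP[F [TF ndF Foo]] := sigma_finiteT (@lebesgue_measure R).
have /sigma_finiteP[G [TG ndG Goo]] := sigma_finiteT mu.
pose g (x : n.+1.-tuple R) : R * n.-tuple R :=
  (tnth x ord0, [tuple of behead x]).
have mg : measurable_fun setT g.
  apply: measurable_fun_pair; first exact: measurable_tnth.
  exact: measurable_behead.
have gK : cancel (@tcons n) g.
  by case=> a t; rewrite /g /tcons /= (tnth_nth 0) /=; congr pair; exact: val_inj.
exists (fun i => g @^-1` (F i `*` G i)).
  rewrite -preimage_bigcup; apply/esym/seteqP; split => // x _.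
  have [i _ Fi] : (\bigcup_i F i) (g x).1 by rewrite -TF.
  have [j _ Gj] : (\bigcup_i G i) (g x).2 by rewrite -TG.
  exists (maxn i j) => //; split.
    by move: Fi; exact/subsetPset/ndF/leq_maxl.
  by move: Gj; exact/subsetPset/ndG/leq_maxr.
move=> i; have [mFi Fi] := Foo i; have [mGi Gi] := Goo i; split.
  by rewrite -[X in measurable X]setTI; apply: mg => //; exact: measurableX.
rewrite /m /pushforward -comp_preimage.
rewrite (_ : g \o _ = id); last by apply/funext => x /=; rewrite gK.
by rewrite preimage_id product_measure1E// lte_mul_pinfty// ge0_fin_numE.
Qed.

HB.instance Definition _ :=
  Measure_isSigmaFinite.Build _ _ _ m m_sigma_finite.

Definition lebesgue_step : {sigma_finite_measure set (n.+1.-tuple R) -> \bar R} :=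
  m.

End step.

Fixpoint lebesgue_tuple n : {sigma_finite_measure set (n.-tuple R) -> \bar R} :=
  match n with
  | 0 => \d_([tuple] : 0.-tuple R)
  | n'.+1 => lebesgue_step (lebesgue_tuple n')
  end.

End Lebesgue.

(** Surface measure of the unit sphere, extended by 0 to R^d: with [Leb] the
    Lebesgue measure of R^d, it is
    sigma(B) = d * Leb {x : 0 < |x| <= 1 and x / |x| is in B}. *)

Section Sphere.
Context {R : realType} (d : nat).

Definition punctured_ball : set (d.-tuple R) := [set x | 0 < tnorm x <= 1].

Lemma measurable_punctured_ball : measurable punctured_ball.
Proof.
rewrite (_ : punctured_ball = @tnorm R d @^-1` `]0, 1]); last first.
  by apply/seteqP; split => x /=; rewrite in_itv.
by rewrite -[X in measurable X]setTI; exact: measurable_tnorm.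
Qed.

Definition direction (x : d.-tuple R) : d.-tuple R := tscale (tnorm x)^-1 x.

Let mdir : measurable_fun [set: d.-tuple R] direction.
Proof.
apply: measurable_tscale => //.
by apply: measurableT_comp; [exact: measurable_inv|exact: measurable_tnorm].
Qed.

Definition sphere_measure : set (d.-tuple R) -> \bar R :=
  pushforward
    (mscale (d%:R)%:nng
      (mrestr (@lebesgue_tuple R d) measurable_punctured_ball))
    direction.

Let s0 : sphere_measure set0 = 0%E. Proof. exact: measure0. Qed.

Let s_ge0 A : (0 <= sphere_measure A)%E. Proof. exact: measure_ge0. Qed.

Let s_sigma_additive : semi_sigma_additive sphere_measure.
Proof. exact: measure_semi_sigma_additive. Qed.

HB.instance Definition _ := isMeasure.Build _ _ _ sphere_measure
  s0 s_ge0 s_sigma_additive.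

End Sphere.

Section Cone.
Context {R : realType} (d : nat).
Local Notation X := (d.-tuple R * R)%type.

Definition V0 : set X := [set p | tnorm p.1 = p.2 /\ 0 <= p.2 <= 1].

Definition cone_param (q : X) : X := (tscale q.2 q.1, q.2).

Let mparam : measurable_fun [set: X] cone_param.
Proof.
by apply: measurable_fun_pair => //; exact: measurable_tscale.
Qed.

Let slab : set X := setT `*` `[0, 1].

Let mslab A : measurable A -> measurable (cone_param @^-1` A `&` slab).
Proof.
move=> mA; apply: measurableI; last exact: measurableX.
by rewrite -[X in measurable X]setTI; exact: mparam.
Qed.

(** dsigma(x, t) = t^(d-1) dsigma_S(xi) dt for x = t xi, 0 <= t <= 1. *)
Definition cone_measure (A : set X) : \bar R :=
  (\int[@sphere_measure R d \x @lebesgue_measure R]_(q in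
     cone_param @^-1` A `&` (setT `*` `[0%R, 1%R])) (q.2 ^+ d.-1)%:E)%E.

Let c0 : cone_measure set0 = 0%E.
Proof. by rewrite /cone_measure preimage_set0 set0I integral_set0. Qed.

Let c_ge0 A : (0 <= cone_measure A)%E.
Proof.
apply: integral_ge0 => q [_ [_ /=]]; rewrite in_itv/= => /andP[q0 _].
by rewrite lee_fin exprn_ge0.
Qed.

Let c_sigma_additive : semi_sigma_additive cone_measure.
Proof.
move=> F mF tF mUF; rewrite /cone_measure preimage_bigcup setI_bigcupl.
rewrite ge0_integral_bigcup.
- apply: is_cvg_ereal_nneg_natsum => n _; exact: c_ge0.
- by move=> k; exact: mslab.
- apply/measurable_EFinP; apply: measurable_funTS; exact: measurable_funX.
- move=> q [k _ [_ [_ /=]]]; rewrite in_itv/= => /andP[q0 _].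
  by rewrite lee_fin exprn_ge0.
- apply/trivIsetP => i j _ _ ij; rewrite setIACA -preimage_setI.
  by move/trivIsetP : tF => /(_ _ _ _ _ ij) -> //; rewrite preimage_set0 set0I.
Qed.

HB.instance Definition _ := isMeasure.Build _ _ _ cone_measure
  c0 c_ge0 c_sigma_additive.

End Cone.

Section Frames.
Context {R : realType} {d : nat}.
Local Notation X := (d.-tuple R * R)%type.
Local Notation V := (@V0 R d).
Local Notation sigma := (@cone_measure R d).
Implicit Types (w f g : X -> R) (p q z : X).

Definition cone_dist p q : R :=
  acos (Num.sqrt ((tdot p.1 q.1 + p.2 * q.2) / 2)
        + Num.sqrt (1 - p.2) * Num.sqrt (1 - q.2)).

Definition cap p (r : R) : set X := [set q | V q /\ cone_dist p q <= r].

Definition weight w : Prop :=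
  (forall p, V p -> 0 <= w p) /\ sigma.-integrable V (EFin \o w).

Definition wmass w (E : set X) : R := \int[sigma]_(p in E) w p.

Definition doubling_weight w : Prop :=
  weight w /\
  exists L : R, forall p r, V p -> 0 < r ->
    wmass w (cap p (2 * r)) <= L * wmass w (cap p r).

Definition inner w f g : R := \int[sigma]_(p in V) (f p * g p * w p).

Definition L2norm w f : \bar R :=
  ((\int[sigma]_(p in V) (f p ^+ 2 * w p)%:E) `^ 2^-1)%E.

Definition in_L2 w f : Prop := measurable_fun V f /\ (L2norm w f < +oo)%E.

(** [mpoly.msize] is the total degree plus one; the last of the [d.+1]
    variables is t. *)

Definition cone_coord p (i : 'I_d.+1) : R := tnth [tuple of rcons p.1 p.2] i.

Definition cone_poly (n : nat) f : Prop :=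
  exists2 P : mpoly.mpoly d.+1 R,
    (mpoly.msize P <= n.+1)%N &
    forall p, V p -> f p = mpoly.meval (cone_coord p) P.

(** Quantifying over all [m < k] makes the condition empty for [k = 0]. *)
Definition orth_poly w (k : nat) f : Prop :=
  cone_poly k f /\
  forall m g, (m < k)%N -> cone_poly m g -> inner w f g = 0.

Definition reproducing_kernel w (k : nat) (P : X -> X -> R) : Prop :=
  (forall q, V q -> orth_poly w k (P ^~ q)) /\
  (forall f q, orth_poly w k f -> V q -> inner w f (P ^~ q) = f q).

(** A separated subset of the compact surface is finite, so that the sums over
    [Xi] below are genuine finite sums. *)

Definition separated (eps : R) (Xi : set X) : Prop :=
  [/\ Xi `<=` V, finite_set Xi &
      forall p q, Xi p -> Xi q -> p != q -> eps <= cone_dist p q].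

Definition maximal_separated (cd eps : R) (Xi : set X) : Prop :=
  separated eps Xi /\
  forall p, V p -> 1 <= \sum_(q \in Xi) (\1_(cap q eps) p : R) <= cd.

Definition admissible_cutoff (a : R -> R) : Prop :=
  [/\ forall t, 0 <= a t,
      forall n t, derivable (derive1n n a) t 1,
      closure [set t | a t != 0] `<=` `[1 / 2, 2],
      exists2 rho : R, 0 < rho & forall t, 3 / 5 <= t <= 5 / 3 -> rho <= a t &
      forall t, 1 / 2 <= t <= 1 -> a t ^+ 2 + a (2 * t) ^+ 2 = 1].

(** [a (k / n)] vanishes for [k > 2 n], so this is the sum over all [k]. *)
Definition cutoff_kernel (a : R -> R) (P : nat -> X -> X -> R) (n : nat) p q : R :=
  \sum_(0 <= k < (2 * n).+1) a (k%:R / n%:R) * P k p q.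

(** The kernel of level 0 is the reproducing kernel of the constants, which is
    the constant 1 exactly when [w] has total mass 1.  (For any other total
    mass, the constant 1 in its place would break the frame identities already
    for [f = 1].) *)
Definition frame_kernel w (a : R -> R) (P : nat -> X -> X -> R) (j : nat) p q : R :=
  match j with
  | 0 => (wmass w V)^-1
  | i.+1 => cutoff_kernel a P (2 ^ i) p q
  end.

(** [Xi j] is the set of nodes of level [j], with weights [lam j].  The square
    of a polynomial of level [j] has degree up to [2 ^ j.+1 - 2], whence the
    degree of exactness. *)
Definition frame_quadrature w (Xi : nat -> set X) (lam : nat -> X -> R) : Prop :=
  [/\ forall j z, Xi j z -> 0 < lam j z,
      forall j f, cone_poly (2 ^ j.+1) f ->
        \int[sigma]_(p in V) (f p * w p) = \sum_(z \in Xi j) lam j z * f z &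
      exists c1 c2 : R, [/\ 0 < c1, 0 < c2 &
        forall j z, Xi j z ->
          c1 * wmass w (cap z (2 ^- j)) <= lam j z <=
          c2 * wmass w (cap z (2 ^- j))]].

Definition frame_element w a P (lam : nat -> X -> R) (j : nat) z p : R :=
  Num.sqrt (lam j z) * frame_kernel w a P j p z.

End Frames.

(* Main.v *)
(* The component f_k = <f, P_k(., q)>_w of f is, as a function of q, the
   difference of the orthogonal projections of f on polynomials of degree k and
   k - 1; hence it is a polynomial.  The quadrature rule, applied to the
   polynomial q |-> <f, F_j(., q)>_w F_j(p, q), turns level j of the frame
   expansion into sum_k c_j(k)^2 f_k(p), where c_j(k) is the cutoff value, and
   likewise turns the squared coefficients into sum_k c_j(k)^2 |f_k|^2.  Since
   sum_j c_j(k)^2 = 1, everything follows from Parseval's identity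
   |f|^2 = sum_k |f_k|^2, that is, from the density of polynomials.  For the
   density, the sets E such that multiplication by 1_E preserves the L^2-closure
   of the polynomials form a sigma-algebra; it contains the coordinate
   half-spaces, whose indicators are bounded pointwise limits of explicit
   polynomials. *)

Require Import Defs.
From mathcomp Require Import all_boot all_order all_algebra.
From mathcomp Require mpoly.
Import (canonicals, coercions) mpoly.
From mathcomp Require Import all_classical all_reals all_analysis.
From mathcomp Require Import measurable_realfun ring lra.

Set Implicit Arguments.
Unset Strict Implicit.
Unset Printing Implicit Defensive.

Import Order.TTheory GRing.Theory Num.Theory.
Import numFieldNormedType.Exports.

Local Open Scope classical_set_scope.
Local Open Scope ring_scope.

(** * Weighted L^2 spaces *)

Section WeightedL2.
Context d (T : measurableType d) (R : realType).
Variables (mu : {measure set T -> \bar R}) (D : set T) (w : T -> R).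
Hypotheses (mD : measurable D) (w0 : forall x, D x -> 0 <= w x).
Hypothesis iw : mu.-integrable D (EFin \o w).

Definition wdot (f g : T -> R) : R := \int[mu]_(x in D) (f x * g x * w x).

Definition wL2 (f : T -> R) : Prop :=
  measurable_fun D f /\ mu.-integrable D (EFin \o (fun x => f x ^+ 2 * w x)).

Let mw : measurable_fun D w.
Proof. by apply/measurable_EFinP; case/integrableP: iw. Qed.

Lemma eq_wdot (f f' g g' : T -> R) :
  {in D, f =1 f'} -> {in D, g =1 g'} -> wdot f g = wdot f' g'.
Proof. by move=> ff gg; apply: eq_Rintegral => x xD; rewrite ff// gg. Qed.

Lemma wdotC (f g : T -> R) : wdot f g = wdot g f.
Proof. by apply: eq_Rintegral => x _; rewrite (mulrC (f x)). Qed.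

Lemma wdot_ge0 (f : T -> R) : 0 <= wdot f f.
Proof.
by apply: Rintegral_ge0 => x Dx; rewrite mulr_ge0 ?w0// -expr2 sqr_ge0.
Qed.

(** The majorant is [(f^2 + g^2) w], because [|f g| <= f^2 + g^2]. *)
Lemma wL2_integrable (f g : T -> R) : wL2 f -> wL2 g ->
  mu.-integrable D (EFin \o (fun x => f x * g x * w x)).
Proof.
move=> [mf jf] [mg jg].
apply: (@le_integrable _ _ _ _ _ mD _
    (EFin \o (fun x => f x ^+ 2 * w x + g x ^+ 2 * w x))).
- by apply/measurable_EFinP; apply: measurable_funM => //; apply: measurable_funM.
- move=> x Dx /=; have w0x := w0 Dx; rewrite lee_fin.
  rewrite [leRHS]ger0_norm; last by rewrite -mulrDl mulr_ge0// addr_ge0 ?sqr_ge0.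
  rewrite normrM (ger0_norm w0x) -mulrDl ler_wpM2r// normrM.
  rewrite -(real_normK (num_real (f x))) -(real_normK (num_real (g x))).
  move: `|f x| `|g x| (normr_ge0 (f x)) (normr_ge0 (g x)) => a b a0 b0.
  by have := sqr_ge0 (a - b); nra.
- rewrite (_ : _ \o _ = (EFin \o (fun x => f x ^+ 2 * w x)) \+
      (EFin \o (fun x => g x ^+ 2 * w x))); last by apply/funext.
  exact: integrableD.
Qed.

Lemma wL2_eq (f g : T -> R) : {in D, f =1 g} -> wL2 f -> wL2 g.
Proof.
move=> fg [mf jf]; split; first exact: eq_measurable_fun mf.
by apply: eq_integrable jf => // x xD /=; rewrite fg.
Qed.

Lemma wL2_le (f g : T -> R) : measurable_fun D f ->
  (forall x, D x -> `|f x| <= `|g x|) -> wL2 g -> wL2 f.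
Proof.
move=> mf fg [mg jg]; split => //; apply: le_integrable jg => //.
  by apply/measurable_EFinP; apply: measurable_funM => //; apply: measurable_funX.
move=> x Dx /=; rewrite lee_fin (normrM _ (w x)) (normrM _ (w x)) ler_wpM2r//.
by rewrite !normrX lerXn2r ?nnegrE// fg.
Qed.

Lemma wL2D (f g : T -> R) : wL2 f -> wL2 g -> wL2 (fun x => f x + g x).
Proof.
move=> [mf jf] [mg jg]; split; first exact: measurable_funD.
apply: (@le_integrable _ _ _ _ _ mD _
    (EFin \o (fun x => 2 * (f x ^+ 2 * w x + g x ^+ 2 * w x)))).
- by apply/measurable_EFinP; apply: measurable_funM => //; apply: measurable_funX;
    apply: measurable_funD.
- move=> x Dx /=; have w0x := w0 Dx; rewrite lee_fin !ger0_norm; last 2 first.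
  + by rewrite -mulrDl !mulr_ge0// addr_ge0 ?sqr_ge0.
  + by rewrite mulr_ge0// sqr_ge0.
  rewrite -mulrDl mulrA ler_wpM2r//.
  by have := sqr_ge0 (f x - g x); nra.
- rewrite (_ : _ \o _ = fun x => 2%:E * ((EFin \o (fun x => (f x ^+ 2 * w x)%R))
      \+ (EFin \o (fun x => (g x ^+ 2 * w x)%R))) x)%E; last by apply/funext.
  by apply: integrableZl => //; apply: integrableD.
Qed.

Lemma wL2Z (c : R) (f : T -> R) : wL2 f -> wL2 (fun x => c * f x).
Proof.
move=> [mf jf]; split; first exact: measurable_funM.
rewrite (_ : _ \o _ =
  fun x => (c ^+ 2)%:E * (EFin \o (fun x => (f x ^+ 2 * w x)%R)) x)%E.
  exact: integrableZl.
by apply/funext => x /=; rewrite exprMn -mulrA EFinM.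
Qed.

Lemma wL2B (f g : T -> R) : wL2 f -> wL2 g -> wL2 (fun x => f x - g x).
Proof.
move=> lf /(wL2Z (-1)) lg; apply: wL2_eq (wL2D lf lg) => x _.
by rewrite mulN1r.
Qed.

Lemma wL2_cst (c : R) : wL2 (fun=> c).
Proof. by split => //; have := integrableZl mD (c ^+ 2) iw. Qed.

Lemma wL2_bounded (f : T -> R) (M : R) : measurable_fun D f ->
  (forall x, D x -> `|f x| <= M) -> wL2 f.
Proof.
move=> mf fM; apply: wL2_le (wL2_cst M) => // x Dx.
by rewrite (le_trans (fM x Dx))// ler_norm.
Qed.

Lemma wL2_sum (I : Type) (s : seq I) (F : I -> T -> R) :
  (forall i, wL2 (F i)) -> wL2 (fun x => \sum_(i <- s) F i x).
Proof.
move=> lF; elim: s => [|i s ih].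
  by apply: wL2_eq (wL2_cst 0) => x _; rewrite big_nil.
by apply: wL2_eq (wL2D (lF i) ih) => x _; rewrite big_cons.
Qed.

Lemma wdotDl (f g h : T -> R) : wL2 f -> wL2 g -> wL2 h ->
  wdot (fun x => f x + g x) h = wdot f h + wdot g h.
Proof.
move=> lf lg lh; rewrite /wdot -RintegralD//; try exact: wL2_integrable.
by apply: eq_Rintegral => x _; ring.
Qed.

Lemma wdotZl (c : R) (f h : T -> R) : wL2 f -> wL2 h ->
  wdot (fun x => c * f x) h = c * wdot f h.
Proof.
move=> lf lh; rewrite /wdot -RintegralZl//; last exact: wL2_integrable.
by apply: eq_Rintegral => x _; ring.
Qed.

Lemma wdotBl (f g h : T -> R) : wL2 f -> wL2 g -> wL2 h ->
  wdot (fun x => f x - g x) h = wdot f h - wdot g h.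
Proof.
move=> lf lg lh; rewrite /wdot -RintegralB//; try exact: wL2_integrable.
by apply: eq_Rintegral => x _; ring.
Qed.

Lemma wdotBr (f g h : T -> R) : wL2 f -> wL2 g -> wL2 h ->
  wdot h (fun x => f x - g x) = wdot h f - wdot h g.
Proof. by move=> lf lg lh; rewrite wdotC wdotBl// !(wdotC h). Qed.

Lemma wdotZr (c : R) (f h : T -> R) : wL2 f -> wL2 h ->
  wdot h (fun x => c * f x) = c * wdot h f.
Proof. by move=> lf lh; rewrite wdotC wdotZl// wdotC. Qed.

Lemma wdot_suml (I : Type) (s : seq I) (F : I -> T -> R) (h : T -> R) :
  (forall i, wL2 (F i)) -> wL2 h ->
  wdot (fun x => \sum_(i <- s) F i x) h = \sum_(i <- s) wdot (F i) h.
Proof.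
move=> lF lh; elim: s => [|i s ih].
  rewrite big_nil (@eq_wdot _ (fun x => 0 * 0) _ h)//; last first.
    by move=> x _; rewrite big_nil mul0r.
  by rewrite wdotZl ?mul0r//; exact: wL2_cst.
rewrite big_cons -ih -wdotDl//; last exact: wL2_sum.
by apply: eq_wdot => // x _; rewrite big_cons.
Qed.

Lemma wdot_sumr (I : Type) (s : seq I) (F : I -> T -> R) (h : T -> R) :
  (forall i, wL2 (F i)) -> wL2 h ->
  wdot h (fun x => \sum_(i <- s) F i x) = \sum_(i <- s) wdot h (F i).
Proof.
move=> lF lh; rewrite wdotC wdot_suml//.
by apply: eq_bigr => i _; exact: wdotC.
Qed.

Lemma wdot_sqrD (f g : T -> R) : wL2 f -> wL2 g ->
  wdot (fun x => f x + g x) (fun x => f x + g x) =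
  wdot f f + 2 * wdot f g + wdot g g.
Proof.
move=> lf lg; have lfg := wL2D lf lg.
rewrite wdotDl// (wdotC f) (wdotC g) !wdotDl// (wdotC g f); ring.
Qed.

(** The form is only semidefinite, so a null vector need not vanish. Along it, however, the
    quadratic [|t f + h|^2] is affine in [t], and a nonzero slope would make it negative
    somewhere. *)
Lemma wdot_eq0 (f h : T -> R) : wL2 f -> wL2 h ->
  wdot f f = 0 -> wdot f h = 0.
Proof.
move=> lf lh f0; apply/eqP/negPn/negP => fh0.
(* Solves [2 t <f, h> + <h, h> = -1]. *)
pose t := - (wdot h h + 1) / (2 * wdot f h).
have lt := wL2Z t lf.
have := wdot_ge0 (fun x => t * f x + h x).
rewrite wdot_sqrD// !(wdotZl, wdotZr)// f0.
suff -> : t * (t * 0) + 2 * (t * wdot f h) + wdot h h = -1 by lra.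
by rewrite /t; field.
Qed.

(** Parallelogram law with [|f - g|^2] dropped; it serves as a triangle inequality for squared
    norms. *)
Lemma wdot_sqrD_le (f g : T -> R) : wL2 f -> wL2 g ->
  wdot (fun x => f x + g x) (fun x => f x + g x) <=
  2 * wdot f f + 2 * wdot g g.
Proof.
move=> lf lg; have := wdot_ge0 (fun x => f x - g x).
have lfg' := wL2B lf lg.
rewrite (wdot_sqrD lf lg) wdotBl// !wdotBr// (wdotC g f); lra.
Qed.

Lemma wdot_le (f g : T -> R) : wL2 f -> wL2 g ->
  (forall x, D x -> `|f x| <= `|g x|) -> wdot f f <= wdot g g.
Proof.
move=> lf lg fg; apply: le_Rintegral => //; try exact: wL2_integrable.
move=> x Dx; rewrite ler_wpM2r ?w0// -!expr2.
rewrite -(real_normK (num_real (f x))) -(real_normK (num_real (g x))).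
by rewrite lerXn2r ?nnegrE// fg.
Qed.

(** Dominated convergence for [(f - f_n)^2 w], with majorant [g^2 w]. *)
Lemma wL2_dominated_cvg (f_ : nat -> T -> R) (f g : T -> R) :
  (forall n, measurable_fun D (f_ n)) -> measurable_fun D f -> wL2 g ->
  (forall x, D x -> f_ n x @[n --> \oo] --> f x) ->
  (forall n x, D x -> `|f x - f_ n x| <= `|g x|) ->
  wdot (fun x => f x - f_ n x) (fun x => f x - f_ n x) @[n --> \oo] --> 0.
Proof.
move=> mf_ mf [mg jg] cf fg.
pose F n x := ((f x - f_ n x) ^+ 2 * w x)%:E.
have mF n : measurable_fun D (F n).
  apply/measurable_EFinP; apply: measurable_funM => //.
  by apply: measurable_funX; apply: measurable_funB.
have cF : {ae mu, forall x, D x -> F ^~ x @ \oo --> 0%E}.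
  apply: aeW => x Dx; apply: cvg_EFin; first exact: nearW.
  rewrite (_ : _ \o _ = fun n => (f x - f_ n x) ^+ 2 * w x)//.
  have c0 : f x - f_ n x @[n --> \oo] --> 0.
    by rewrite -(subrr (f x)); apply: cvgB; [exact: cvg_cst|exact: cf].
  rewrite -(mul0r (w x)); apply: cvgM; last exact: cvg_cst.
  under eq_fun do rewrite expr2.
  by rewrite -(mulr0 0); exact: cvgM.
have dF : {ae mu, forall x n, D x ->
    (`|F n x| <= (EFin \o (fun x => (g x ^+ 2 * w x)%R)) x)%E}.
  apply: aeW => x n Dx; rewrite /F /= lee_fin normrM (ger0_norm (w0 Dx)).
  rewrite ler_wpM2r ?w0// normrX -(real_normK (num_real (g x))).
  by rewrite lerXn2r ?nnegrE// fg.
have [_ _] := dominated_convergence mD mF (@measurable_cst _ _ _ _ _ _) cF jg dF.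
rewrite integral_cst//= mul0e => /fine_cvg /=.
apply: cvg_trans; apply: near_eq_cvg; apply: nearW => n /=.
by apply: eq_Rintegral => x _; rewrite expr2.
Qed.

(** Gram-Schmidt by induction on [s], without normalisation or linear independence. The second
    clause stands for membership of [g] in the span of the [F i]: in the induction it turns
    orthogonality to the [F j] into orthogonality to their projection [q]. *)
Lemma wL2_projection (S : set (T -> R)) (I : eqType) (s : seq I) (F : I -> T -> R) :
  S (fun=> 0) ->
  (forall c g h, S g -> S h -> S (fun x => g x + c * h x)) ->
  (forall g, S g -> wL2 g) -> (forall i, S (F i)) ->
  forall f, wL2 f -> exists g, [/\ S g,
    forall u, wL2 u -> {in s, forall i, wdot u (F i) = 0} -> wdot u g = 0 &
    {in s, forall i, wdot (fun x => f x - g x) (F i) = 0}].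
Proof.
move=> S0 SL lS SF; have lF i := lS _ (SF i); have l0 := lS _ S0.
elim: s => [|i s ih] f lf.
  exists (fun=> 0); split => // u lu _.
  rewrite (@eq_wdot u u (fun=> 0) (fun x => 0 * 0))//; last by move=> ? _; rewrite mulr0.
  by rewrite wdotZr// mul0r.
(* [g] and [q] project [f] and the new vector [F i] on the vectors indexed by [s]; [h = F i - q]
   will be the new orthogonal direction. *)
have [g [Sg sg gs]] := ih f lf; have [q [Sq sq qs]] := ih _ (lF i).
have lg := lS _ Sg; have lq := lS _ Sq.
pose h x := F i x - q x; pose r x := f x - g x.
have lh : wL2 h by exact: wL2B.
have lr : wL2 r by exact: wL2B.
pose t := wdot r h / wdot h h.
have Sh : S h.
  rewrite (_ : h = fun x => F i x + (-1) * q x); first exact: SL.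
  by apply/funext => x; rewrite mulN1r.
have lth : wL2 (fun x => t * h x) by exact: wL2Z.
pose v x := r x - t * h x.
have lv : wL2 v by exact: wL2B.
have vE : (fun x => f x - (g x + t * h x)) = v by apply/funext => x; rewrite /v /r; ring.
have vs : {in s, forall j, wdot v (F j) = 0}.
  by move=> j js; rewrite wdotBl// wdotZl// /r /h gs// qs// mulr0 subrr.
have vh : wdot v h = 0.
  (* If [h] is a null vector, [t] divides by zero, but then [<r, h> = 0] as well. *)
  rewrite wdotBl// wdotZl// /t; have [h0|h0] := eqVneq (wdot h h) 0.
    by rewrite h0 mulr0 subr0 wdotC wdot_eq0.
  by rewrite divfK ?subrr.
exists (fun x => g x + t * h x); split; first exact: SL.
  move=> u lu us.
  have us' : {in s, forall j, wdot u (F j) = 0}.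
    by move=> j js; apply: us; rewrite in_cons js orbT.
  rewrite wdotC wdotDl// wdotZl// (wdotC g) (wdotC h) sg// add0r.
  by rewrite /h wdotBr// us ?mem_head// sq// subrr mulr0.
rewrite vE => j; rewrite in_cons => /predU1P[->|]; last exact: vs.
move: vh; rewrite /h wdotBr// (sq _ lv vs) subr0.
by [].
Qed.

(** * Density of an algebra of functions in the weighted space *)

Section Density.
Variable S : set (T -> R).
Hypothesis S1 : S (fun=> 1).
Hypothesis SL : forall c g h, S g -> S h -> S (fun x => g x + c * h x).
Hypothesis SM : forall g h, S g -> S h -> S (fun x => g x * h x).
Hypothesis mS : forall g, S g -> wL2 g.

Definition wL2_closure (h : T -> R) : Prop := wL2 h /\
  forall e, 0 < e -> exists2 g, S g &
    wdot (fun x => h x - g x) (fun x => h x - g x) < e.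

Lemma subset_wL2_closure g : S g -> wL2_closure g.
Proof.
move=> Sg; split; first exact: mS.
move=> e e0; exists g => //; have lg := mS Sg.
rewrite wdotBl//; last exact: wL2B.
by rewrite subrr.
Qed.

Lemma wL2_closureK h : wL2 h -> (forall e, 0 < e -> exists2 g, wL2_closure g &
    wdot (fun x => h x - g x) (fun x => h x - g x) < e) -> wL2_closure h.
Proof.
move=> lh H; split => // e e0.
(* [wdot_sqrD_le] doubles each of the two squared errors, so [e / 4] for each suffices. *)
have e40 : 0 < e / 4 by rewrite divr_gt0.
have [g [lg Hg] hg] := H _ e40; have [k Sk gk] := Hg _ e40.
have lk := mS Sk.
exists k => //.
have := wdot_sqrD_le (wL2B lh lg) (wL2B lg lk).
rewrite [X in X <= _](_ : _ = wdot (fun x => h x - k x) (fun x => h x - k x)).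
  by move=> H1; lra.
by apply: eq_wdot => x _; ring.
Qed.

Lemma wL2_closureL c g h : wL2_closure g -> wL2_closure h ->
  wL2_closure (fun x => g x + c * h x).
Proof.
move=> [lg Hg] [lh Hh]; split; first by apply: wL2D => //; exact: wL2Z.
move=> e e0.
have e40 : 0 < e / 4 by rewrite divr_gt0.
(* The [+ 1] covers [c = 0] and makes [c^2 / (c^2 + 1)] less than one. *)
have c10 : 0 < c ^+ 2 + 1 by rewrite ltr_wpDl ?sqr_ge0.
have ec0 : 0 < e / (4 * (c ^+ 2 + 1)) by rewrite divr_gt0// mulr_gt0.
have [g' Sg' gg'] := Hg _ e40; have [h' Sh' hh'] := Hh _ ec0.
have lg' := mS Sg'; have lh' := mS Sh'.
exists (fun x => g' x + c * h' x); first exact: SL.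
have lhh : wL2 (fun x => h x - h' x) by exact: wL2B.
have := wdot_sqrD_le (wL2B lg lg') (wL2Z c lhh).
rewrite wdotZl ?wdotZr//; last exact: wL2Z.
rewrite [X in X <= _](_ : _ = wdot (fun x => g x + c * h x - (g' x + c * h' x))
    (fun x => g x + c * h x - (g' x + c * h' x))); last first.
  by apply: eq_wdot => x _; ring.
move=> H1.
suff : c * (c * wdot (fun x => h x - h' x) (fun x => h x - h' x)) < e / 4 by lra.
rewrite mulrA -expr2.
rewrite (@le_lt_trans _ _ (c ^+ 2 * (e / (4 * (c ^+ 2 + 1)))))//.
  by rewrite ler_wpM2l ?sqr_ge0// ltW.
have -> : c ^+ 2 * (e / (4 * (c ^+ 2 + 1))) = (e / 4) * (c ^+ 2 / (c ^+ 2 + 1)).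
  by field; rewrite gt_eqF.
by rewrite gtr_pMr// ltr_pdivrMr// mul1r ltrDl.
Qed.

Lemma wL2_closureZ c h : wL2_closure h -> wL2_closure (fun x => c * h x).
Proof.
move=> Hh; rewrite (_ : (fun x => _) = fun x => h x + (c - 1) * h x).
  exact: wL2_closureL.
by apply/funext => x; ring.
Qed.

Lemma wL2_closure_sum (I : Type) (s : seq I) (F : I -> T -> R) :
  (forall i, wL2_closure (F i)) -> wL2_closure (fun x => \sum_(i <- s) F i x).
Proof.
move=> HF; elim: s => [|i s ih].
  rewrite (_ : (fun x => _) = fun x => 0 * 1).
    exact/wL2_closureZ/subset_wL2_closure.
  by apply/funext => x; rewrite big_nil mul0r.
rewrite (_ : (fun x => _) = fun x => F i x + 1 * \sum_(j <- s) F j x).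
  exact: wL2_closureL.
by apply/funext => x; rewrite big_cons mul1r.
Qed.

Lemma wL2_closure_dominated_cvg (f_ : nat -> T -> R) (f g : T -> R) :
  (forall n, wL2_closure (f_ n)) -> wL2 f -> wL2 g ->
  (forall x, D x -> f_ n x @[n --> \oo] --> f x) ->
  (forall n x, D x -> `|f x - f_ n x| <= `|g x|) -> wL2_closure f.
Proof.
move=> Hf lf lg cf fg; apply: wL2_closureK => // e e0.
have mf_ n : measurable_fun D (f_ n) by have [[]] := Hf n.
have /cvgrPdist_lt /(_ _ e0) := wL2_dominated_cvg mf_ lf.1 lg cf fg.
move=> [N _ /(_ N (leqnn N))]; rewrite sub0r normrN ger0_norm ?wdot_ge0// => H.
by exists (f_ N).
Qed.

(** Multiplication by [g] does not increase the norm and preserves [S], so it carries approximants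
    of [h] to approximants of [g h]. *)
Lemma wL2_closureM_bounded g h : S g -> (forall x, D x -> `|g x| <= 1) ->
  wL2_closure h -> wL2_closure (fun x => g x * h x).
Proof.
move=> Sg g1 [lh Hh].
have [mg _] := mS Sg.
have M u : wL2 u -> wL2 (fun x => g x * u x) /\
    wdot (fun x => g x * u x) (fun x => g x * u x) <= wdot u u.
  move=> lu; have [mu' _] := lu.
  have gu x : D x -> `|g x * u x| <= `|u x|.
    by move=> Dx; rewrite normrM ler_piMl// g1.
  have lgu : wL2 (fun x => g x * u x) by apply: wL2_le gu lu; exact: measurable_funM.
  by split => //; exact: wdot_le.
split; first by have [] := M _ lh.
move=> e e0; have [k Sk hk] := Hh _ e0.
exists (fun x => g x * k x); first exact: SM.
apply: le_lt_trans hk; have [_] := M _ (wL2B lh (mS Sk)); apply: le_trans.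
by rewrite le_eqVlt; apply/orP; left; apply/eqP; apply: eq_wdot => x _; ring.
Qed.

Definition multiplier (E : set T) : Prop := measurable E /\
  forall h, wL2_closure h -> wL2_closure (fun x => \1_E x * h x).

(** Dominated convergence with majorant [|h|], since two numbers in [[0, 1]] differ by at most
    one. *)
Lemma multiplier_cvg (E_ : nat -> T -> R) (E : set T) : measurable E ->
  (forall n h, wL2_closure h -> wL2_closure (fun x => E_ n x * h x)) ->
  (forall n x, D x -> 0 <= E_ n x <= 1) ->
  (forall x, D x -> E_ n x @[n --> \oo] --> (\1_E x : R)) ->
  multiplier E.
Proof.
move=> mE HE E01 cE; split => // h Hh; have lh := Hh.1.
have b01 x : 0 <= (\1_E x : R) <= 1 by rewrite indicE; case: (x \in E); rewrite /= ?lexx ?ler01.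
apply: (@wL2_closure_dominated_cvg (fun n x => E_ n x * h x) _ h) => //.
- by move=> n; apply: HE.
- apply: wL2_le (lh).
    apply: measurable_funM; last by case: lh.
    exact: measurable_indic.
  move=> x _; have /andP[? ?] := b01 x.
  by rewrite normrM ger0_norm// ler_piMl.
- by move=> x Dx; apply: cvgM; [exact: cE|exact: cvg_cst].
- move=> n x Dx; rewrite -mulrBl normrM ler_piMl// ler_norml.
  have /andP[? ?] := b01 x; have /andP[? ?] := E01 n x Dx.
  lra.
Qed.

(** Complements come from [1 - 1_A], intersections from multiplying twice, finite unions by De
    Morgan, and countable unions as pointwise limits of finite ones. *)
Lemma multiplier_sigma_algebra : sigma_algebra setT multiplier.
Proof.
have QC A : multiplier A -> multiplier (~` A).
  move=> [mA HA]; split; first exact: measurableC.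
  move=> h Hh; rewrite (_ : (fun x => _) = fun x => h x + (-1) * (\1_A x * h x)).
    by apply: wL2_closureL => //; exact: HA.
  by apply/funext => x; rewrite !indicE in_setC; case: (x \in A) => /=; ring.
have Q0 : multiplier set0.
  split => // h Hh; rewrite (_ : (fun x => _) = fun x => 0 * h x).
    exact: wL2_closureZ.
  by apply/funext => x; rewrite indic0.
have QU A B : multiplier A -> multiplier B -> multiplier (A `|` B).
  move=> /QC[mA HA] /QC[mB HB]; rewrite -[_ `|` _]setCK; apply: QC; rewrite setCU.
  split; first exact: measurableI.
  move=> h Hh; rewrite (_ : (fun x => _) = fun x => \1_(~` A) x * (\1_(~` B) x * h x)).
    by apply: HA; exact: HB.
  by apply/funext => x; rewrite !indicE in_setI; case: (x \in _); case: (x \in _) => /=; ring.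
split => //; first by move=> A QA; rewrite setTD; exact: QC.
move=> F QF; pose U n := \big[setU/set0]_(i < n) F i.
have QFU n : multiplier (U n).
  by rewrite /U; elim/big_ind : _ => // i _.
apply: (@multiplier_cvg (fun n => \1_(U n))).
- by apply: bigcupT_measurable => n; have [] := QF n.
- by move=> n; have [] := QFU n.
- by move=> n x _; rewrite indicE; case: (_ \in _); rewrite /= ?lexx ?ler01.
- move=> x _; have [[k _ Fkx]|nFx] := pselect ((\bigcup_n F n) x).
    apply: cvg_near_cst; exists k.+1 => // n /= kn.
    rewrite !indicE !mem_set//; first by exists k.
    by rewrite /U -bigcup_mkord; exists k.
  apply: cvg_near_cst; apply: nearW => n.
  rewrite !indicE !memNset// /U -bigcup_mkord => -[k _ Fkx].
  by apply: nFx; exists k.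
Qed.

Import HBSimple.

(** The generators are multipliers, hence so is every measurable set. Acting on the constant 1,
    these put indicators in the closure, then simple functions, then every square-integrable
    function. *)
Lemma wL2_dense (G : set (set T)) :
  (forall E, measurable E -> <<s G >> E) ->
  (forall E, G E -> measurable E /\ exists s_ : nat -> T -> R,
    [/\ forall n, S (s_ n), forall n x, D x -> 0 <= s_ n x <= 1 &
        forall x, D x -> s_ n x @[n --> \oo] --> (\1_E x : R)]) ->
  forall f, wL2 f -> wL2_closure f.
Proof.
move=> sG GS f lf.
have QE E : measurable E -> multiplier E.
  move=> /sG; apply: smallest_sub; first exact: multiplier_sigma_algebra.
  move=> {}E /GS[mE [s_ [Ss s01 cs]]]; apply: (@multiplier_cvg s_) => // n h Hh.
  apply: wL2_closureM_bounded => // x Dx.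
  by have /andP[s0 s1] := s01 n x Dx; rewrite ger0_norm.
have Qsfun (g : {sfun T >-> R}) : wL2_closure g.
  have -> := funext (fimfunEord g).
  apply: wL2_closure_sum => i; apply: wL2_closureZ.
  set y := nth _ _ _; have [|_ /(_ _ (subset_wL2_closure S1))] := QE (g @^-1` [set y]).
    exact: measurable_funPTI.
  by congr wL2_closure; apply/funext => x; rewrite mulr1.
have [mf _] := lf.
have [g_ cg] := approximation_sfun mD (measurableT_comp (@EFin_measurable _ setT) mf).
have {}cg x : D x -> g_ n x @[n --> \oo] --> f x by move=> /cg /fine_cvg.
(* The simple functions converge only pointwise. Cutting them off where they are further than 1 from
   [f] bounds the error by [1 + |f|], and each point of [D] eventually lies in [E n]. *)
pose E n := D `&` [set x | `|g_ n x - f x| <= 1].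
have mE n : measurable (E n).
  have := @measurable_fun_le _ _ _ D (fun x => `|g_ n x - f x|) (cst 1) mD.
  apply => //; apply: measurableT_comp => //; apply: measurable_funB => //.
  exact: measurable_funTS.
apply: (@wL2_closure_dominated_cvg (fun n x => \1_(E n) x * g_ n x) f (fun x => 1 + `|f x|)).
- by move=> n; have [_] := QE _ (mE n); apply; exact: Qsfun.
- by [].
- apply: wL2D; first exact: wL2_cst.
  by apply: wL2_le lf => [|x _]; [exact: measurableT_comp|rewrite normr_id].
- move=> x Dx; have /cvgrPdist_le /(_ 1 ltr01) ev := cg x Dx.
  apply: cvg_trans (cg x Dx); apply: near_eq_cvg.
  near=> n; rewrite indicE mem_set ?mul1r//; split => //=.
  by rewrite distrC; near: n.
- move=> n x Dx; rewrite [leRHS]ger0_norm ?addr_ge0//.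
  rewrite indicE; have [/set_mem[_ /=]|_] := boolP (x \in E n).
    by rewrite mul1r distrC => H; rewrite (le_trans H)// lerDl.
  by rewrite mul0r subr0 lerDr.
Unshelve. all: by end_near. Qed.

End Density.

End WeightedL2.

(** * Polynomials on the cone *)

Section PolynomialStep.
Context {R : realType}.

Lemma bernoulli_le (y : R) (m : nat) : 0 <= y <= 1 -> 1 - y *+ m <= (1 - y) ^+ m.
Proof.
move=> /andP[y0 y1]; elim: m => [|m ih]; first by rewrite mulr0n subr0 expr0.
rewrite exprS mulrS (le_trans _ (ler_wpM2l _ ih)) ?subr_ge0//.
have := mulrn_wge0 m y0; move: (y *+ m) => z z0.
by have := mulr_ge0 y0 z0; lra.
Qed.

(** Each of the [n] terms of the geometric sum [(1 - z^n) / (1 - z)] is at least [z^n]; the form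
    without division includes [z = 1]. *)
Lemma mulrn_expr_le (z : R) (n : nat) : 0 <= z <= 1 ->
  n%:R * z ^+ n * (1 - z) <= 1 - z ^+ n.
Proof.
move=> /andP[z0 z1]; elim: n => [|n ih].
  by rewrite !mul0r expr0 subrr.
have zn0 : 0 <= z ^+ n by rewrite exprn_ge0.
have zn1 : z ^+ n <= 1 by rewrite exprn_ile1.
rewrite exprS -natr1; move: ih zn0 zn1; move: (z ^+ n) (n%:R) => a b ih a0 a1.
have := ler_wpM2l z0 ih.
have : 0 <= (1 - z) * (1 - z * a).
  by rewrite mulr_ge0 ?subr_ge0//; nra.
by lra.
Qed.

(* [poly_step n x] approximates the indicator of [x < 1 / 2] on [[0, 1]]; the
   factor [n] in the exponent makes the limit at [x = 1 / 2] equal to 0. *)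
Definition poly_step (n : nat) (x : R) : R := (1 - x ^+ (2 * n)) ^+ (n * 4 ^ n).

Lemma poly_step01 (n : nat) (x : R) : 0 <= x <= 1 -> 0 <= poly_step n x <= 1.
Proof.
move=> /andP[x0 x1]; have := exprn_ge0 (2 * n) x0; have := exprn_ile1 (2 * n) x0 x1.
move=> h1 h0; rewrite /poly_step exprn_ge0 ?subr_ge0//=.
by rewrite exprn_ile1 ?subr_ge0// lerBlDr lerDl.
Qed.

(** Bernoulli's inequality for [y = x^(2n)], as [n 4^n x^(2n) = n (2x)^(2n)]. The power is split
    because, for [2x < 1], [n (2x)^n] stays bounded while the other factor tends to zero. *)
Lemma poly_step_ge (n : nat) (x : R) : 0 <= x <= 1 ->
  1 - n%:R * ((2 * x) ^+ n * (2 * x) ^+ n) <= poly_step n x.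
Proof.
move=> /andP[x0 x1]; rewrite /poly_step.
have -> : n%:R * ((2 * x) ^+ n * (2 * x) ^+ n) = x ^+ (2 * n) *+ (n * 4 ^ n).
  rewrite -[RHS]mulr_natr natrM natrX -exprMn exprM -expr2.
  rewrite [RHS]mulrC -mulrA -exprMn; congr (_ * _ ^+ _); ring.
apply: bernoulli_le; rewrite exprn_ge0//=; exact: exprn_ile1.
Qed.

(** With [y = x^(2n)] and [m = n 4^n], the product [(1 - y)^m (1 + y)^m] is at most 1, while
    [(1 + y)^m >= 1 + m y >= n] because [m y = n (2x)^(2n)] and [2x >= 1]. *)
Lemma poly_step_le (n : nat) (x : R) : (0 < n)%N -> 1 / 2 <= x <= 1 -> poly_step n x <= n%:R^-1.
Proof.
move=> n0 /andP[x0 x1]; have x00 : 0 <= x by lra.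
set y := x ^+ (2 * n); set m := (n * 4 ^ n)%N.
have y0 : 0 <= y by rewrite exprn_ge0.
have y1 : y <= 1 by rewrite exprn_ile1.
have my : n%:R <= y *+ m :> R.
  rewrite /y /m -[leRHS]mulr_natr natrM natrX exprM mulrCA -exprMn.
  by rewrite ler_peMr// exprn_ege1//; nra.
have n00 : 0 < n%:R :> R by rewrite ltr0n.
have H1 : (1 - y) ^+ m * (1 + y) ^+ m <= 1.
  by rewrite -exprMn exprn_ile1//; nra.
have H2 : 1 + y *+ m <= (1 + y) ^+ m.
  elim: (m) => [|k ih]; first by rewrite mulr0n addr0 expr0.
  rewrite exprS mulrS (le_trans _ (ler_wpM2l _ ih)) ?addr_ge0//.
  have := mulr_ge0 y0 (mulrn_wge0 k y0); lra.
have H3 : 0 <= (1 - y) ^+ m by rewrite exprn_ge0// subr_ge0.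
rewrite /poly_step -/y -/m -[leRHS]mul1r ler_pdivlMr//.
rewrite (le_trans _ H1)// ler_wpM2l// (le_trans my)// (le_trans _ H2)//.
by rewrite lerDr.
Qed.

Lemma cvg_poly_step (x : R) : 0 <= x <= 1 ->
  poly_step n x @[n --> \oo] --> ((x < 1 / 2)%R%:R : R).
Proof.
move=> x01; have [x12|x12] := ltP x (1 / 2).
  have z01 : 0 <= 2 * x < 1 by move: x01 => /andP[? ?]; apply/andP; split; lra.
  set z := 2 * x in z01; have /andP[z0 z1] := z01.
  apply: (@squeeze_cvgr _ _ _ _ (fun n => 1 - (1 - z)^-1 * z ^+ n) (fun=> 1)).
  - near=> n; have /andP[_ ->] := poly_step01 n x01; rewrite andbT.
    apply: le_trans (poly_step_ge n x01); rewrite -/z lerB// mulrA.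
    rewrite ler_wpM2r ?exprn_ge0// -[leRHS]mul1r ler_pdivlMr ?subr_gt0//.
    have /mulrn_expr_le/le_trans : 0 <= z <= 1 by rewrite z0 ltW.
    by apply; rewrite lerBlDr lerDl exprn_ge0.
  - rewrite [X in _ --> X](_ : _ = 1 - (1 - z)^-1 * 0); last by rewrite mulr0 subr0.
    apply: cvgB; first exact: cvg_cst.
    by apply: cvgM; [exact: cvg_cst|apply: cvg_expr; rewrite ger0_norm].
  - exact: cvg_cst.
apply: (@squeeze_cvgr _ _ _ _ (fun=> 0) (fun n => n%:R^-1)).
- near=> n; have /andP[-> _] /= := poly_step01 n x01.
  apply: poly_step_le; first by near: n; exists 1%N.
  by rewrite x12; case/andP: x01.
- exact: cvg_cst.
- by rewrite -cvg_shiftS /=; exact: cvg_harmonic.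
Unshelve. all: by end_near. Qed.

End PolynomialStep.

(** * Polynomials restricted to the conic surface *)

Section ConePolynomials.
Context {R : realType} {d : nat}.
Local Notation X := (d.-tuple R * R)%type.
Local Notation V := (@V0 R d).
Implicit Types (f g : X -> R) (p q : X).

Lemma measurable_V0 : measurable V.
Proof.
have mn : measurable_fun [set: X] (fun p => tnorm p.1).
  by apply: (measurableT_comp (@measurable_tnorm R d)).
rewrite (_ : V = (fun p => tnorm p.1 - p.2) @^-1` [set 0] `&` (setT `*` `[0, 1])).
  apply: measurableI; last exact: measurableX.
  rewrite -[X in measurable X]setTI.
  by apply: (measurable_funB mn measurable_snd) => //; exact: measurable_set1.
apply/seteqP; split => [p [/= p1 p2]|p [/= p1 [_ p2]]].
  by rewrite p1 subrr; split => //; split => //=; rewrite in_itv.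
by split; [apply/eqP; rewrite -subr_eq0 p1|move: p2; rewrite in_itv].
Qed.

Lemma cone_coordE p (i : 'I_d.+1) :
  cone_coord p i = if unlift ord_max i is Some j then tnth p.1 j else p.2.
Proof.
rewrite /cone_coord (tnth_nth 0) /= nth_rcons size_tuple.
case: unliftP => [j ->|->] /=; last by rewrite ltnn eqxx.
by rewrite [bump _ _](lift_max j) ltn_ord -tnth_nth.
Qed.

Lemma measurable_cone_coord (i : 'I_d.+1) :
  measurable_fun [set: X] (fun p => cone_coord p i).
Proof.
under eq_fun do rewrite cone_coordE.
case: unlift => [j|]; last exact: measurable_snd.
exact: (measurableT_comp (@measurable_tnth _ R d j) measurable_fst).
Qed.

Lemma cone_coord_le1 p (i : 'I_d.+1) : V p -> `|cone_coord p i| <= 1.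
Proof.
move=> [np /andP[p0 p1]]; rewrite cone_coordE.
case: unlift => [j|]; last by rewrite ger0_norm.
rewrite (le_trans _ p1)// -np /tnorm -sqrtr_sqr ler_wsqrtr// /tdot.
rewrite (bigD1 j)//= -expr2 lerDl sumr_ge0// => k _.
by rewrite -expr2 sqr_ge0.
Qed.

Lemma cone_poly_eq n f g : {in V, f =1 g} -> cone_poly n f -> cone_poly n g.
Proof.
by move=> fg [P sP fP]; exists P => // p Vp; rewrite -fg ?inE// fP.
Qed.

Lemma cone_poly_leq m n f : (m <= n)%N -> cone_poly m f -> cone_poly n f.
Proof. by move=> mn [P sP fP]; exists P => //; rewrite (leq_trans sP). Qed.

Lemma cone_poly_cst n (c : R) : cone_poly n (fun _ : X => c).
Proof.
exists (mpoly.mpolyC d.+1 c) => [|p _]; last by rewrite mpoly.mevalC.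
by rewrite mpoly.msizeC; case: (_ != _).
Qed.

Lemma cone_poly_coord (i : 'I_d.+1) : cone_poly 1 (fun p => cone_coord p i).
Proof.
exists (mpoly.mpolyX R (mpoly.mnm1 i)) => [|p _]; last by rewrite mpoly.mevalXU.
by rewrite mpoly.msizeX mpoly.mdeg1.
Qed.

Lemma cone_polyL n (c : R) f g : cone_poly n f -> cone_poly n g ->
  cone_poly n (fun p => f p + c * g p).
Proof.
move=> [P sP fP] [Q sQ gQ]; exists (P + c *: Q).
  rewrite (leq_trans (mpoly.msizeD_le _ _))// geq_max sP /=.
  by rewrite (leq_trans (mpoly.msizeZ_le _ _)).
by move=> p Vp; rewrite mpoly.mevalD mpoly.mevalZ fP// gQ.
Qed.

Lemma cone_polyM m n f g : cone_poly m f -> cone_poly n g ->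
  cone_poly (m + n) (fun p => f p * g p).
Proof.
move=> [P sP fP] [Q sQ gQ]; exists (P * Q); last first.
  by move=> p Vp; rewrite mpoly.mevalM fP// gQ.
have [->|P0] := eqVneq P 0; first by rewrite mul0r mpoly.msize0.
have [->|Q0] := eqVneq Q 0; first by rewrite mulr0 mpoly.msize0.
rewrite mpoly.msizeM// -subn1 leq_subLR (leq_trans (leq_add sP sQ))//.
by rewrite addSn addnS.
Qed.

Lemma cone_poly_sum n (I : Type) (s : seq I) (F : I -> X -> R) :
  (forall i, cone_poly n (F i)) -> cone_poly n (fun p => \sum_(i <- s) F i p).
Proof.
move=> nF; elim: s => [|i s ih].
  by apply: cone_poly_eq (cone_poly_cst n 0) => p _; rewrite big_nil.
by apply: cone_poly_eq (cone_polyL 1 (nF i) ih) => p _; rewrite big_cons mul1r.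
Qed.

Lemma cone_polyX n (k : nat) f : cone_poly n f ->
  cone_poly (k * n) (fun p => f p ^+ k).
Proof.
move=> nf; elim: k => [|k ih].
  by apply: cone_poly_eq (cone_poly_cst _ 1) => p _; rewrite expr0.
rewrite mulSn; apply: cone_poly_eq (cone_polyM nf ih) => p _.
by rewrite exprS.
Qed.

(** [bmultinom d.+1 n.+1] is the finite type of exponents of total degree at most [n], so these
    monomials form a finite spanning family. *)
Definition cone_monomial n (m : mpoly.bmultinom d.+1 n.+1) p : R :=
  \prod_(i < d.+1) cone_coord p i ^+ mpoly.fun_of_multinom (mpoly.bmnm m) i.

Lemma cone_monomial_poly n (m : mpoly.bmultinom d.+1 n.+1) :
  cone_poly n (cone_monomial m).
Proof.
exists (mpoly.mpolyX R (mpoly.bmnm m)) => [|p _]; last by rewrite mpoly.mevalX.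
by rewrite mpoly.msizeX; exact: mpoly.bmdeg.
Qed.

Lemma cone_poly_span n f : cone_poly n f ->
  exists c : mpoly.bmultinom d.+1 n.+1 -> R,
    {in V, f =1 fun p => \sum_m c m * cone_monomial m p}.
Proof.
move=> [P sP fP]; exists (fun m => mpoly.mcoeff (mpoly.bmnm m) P) => p /set_mem Vp.
rewrite fP// {1}(mpoly.mpolywE sP) raddf_sum; apply: eq_bigr => m _.
by rewrite /= mpoly.mevalZ mpoly.mevalX.
Qed.

Lemma cone_poly_bounded n f : cone_poly n f ->
  measurable_fun V f /\ exists M : R, forall p, V p -> `|f p| <= M.
Proof.
move=> /cone_poly_span[c fc].
pose g p := \sum_m c m * cone_monomial (n:=n) m p.
have fg : {in V, g =1 f} by move=> p pV; rewrite fc.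
split.
  apply: eq_measurable_fun fg _; apply: measurable_funTS.
  apply: measurable_sum => m; apply: measurable_funM => //.
  apply: measurable_prod => i _; apply: measurable_funX.
  exact: measurable_cone_coord.
(* Coordinates on the cone are at most one in absolute value, hence so are the monomials. *)
exists (\sum_m `|c m|) => p Vp; rewrite -fg ?inE//.
rewrite (le_trans (ler_norm_sum _ _ _))// ler_sum// => m _.
rewrite normrM ler_piMr// normr_prod.
rewrite -[leRHS](prodr_const_nat 1 0 0) big_geq//.
apply: prodr_ile1 => i; rewrite normr_ge0 normrX exprn_ile1//.
exact: cone_coord_le1.
Qed.

Definition cone_halfspace : set (set X) :=
  [set E | exists i c, E = [set p | cone_coord p i < c]].

Lemma measurable_cone_halfspace E : cone_halfspace E -> measurable E.
Proof.
move=> [i [c ->]].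
rewrite (_ : [set _ | _] = (fun p => cone_coord p i) @^-1` `]-oo, c[%classic).
  by rewrite -[X in measurable X]setTI; exact: measurable_cone_coord.
by apply/seteqP; split => p /=; rewrite in_itv.
Qed.

(** The identity from the sigma-algebra generated by half-spaces to the product one is measurable
    because each coordinate is, the rays []-oo, c[] generating the Borel sets of the line. *)
Lemma measurable_sub_cone_halfspace (E : set X) :
  measurable E -> <<s cone_halfspace >> E.
Proof.
pose Y := g_sigma_algebraType cone_halfspace.
have mc i : measurable_fun [set: Y] (fun y : Y => cone_coord (y : X) i).
  apply: (measurability _ (RGenInftyO.measurableE R)) => // _ [_ [c ->] <-].
  apply: sub_sigma_algebra; exists i, c; apply/seteqP; split => p /=.
    by rewrite in_itv => -[].
  by rewrite in_itv.
suff mid : measurable_fun [set: Y] (idfun : Y -> X).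
  by move=> mE; have := mid measurableT _ mE; rewrite setTI.
apply/measurable_fun_pairP; split; last first.
  have := mc ord_max; congr measurable_fun; apply/funext => p.
  by rewrite cone_coordE unlift_none.
apply/measurable_fun_tnthP => i.
have := mc (lift ord_max i); congr measurable_fun; apply/funext => p /=.
by rewrite cone_coordE liftK.
Qed.

Lemma cone_halfspace_approx E : cone_halfspace E ->
  exists s_ : nat -> X -> R,
    [/\ forall k, exists n, cone_poly n (s_ k),
        forall k p, V p -> 0 <= s_ k p <= 1 &
        forall p, V p -> s_ k p @[k --> \oo] --> (\1_E p : R)].
Proof.
move=> [i [c ->]].
(* [M] bounds [|cone_coord p i - c|] on the cone, so the affine map [x] sends the cone into [[0, 1]]
   and the threshold [c] to [1 / 2]. *)
pose M : R := 1 + `|c|; have M0 : 0 < M by rewrite ltr_pwDl.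
pose x p : R := 1 / 2 + (cone_coord p i - c) / (2 * M).
have M20 : 0 < 2 * M by rewrite mulr_gt0.
have x01 p : V p -> 0 <= x p <= 1.
  move=> Vp.
  have : `|(cone_coord p i - c) / M| <= 1.
    rewrite normf_div (gtr0_norm M0) ler_pdivrMr// mul1r.
    by rewrite (le_trans (ler_normB _ _))// lerD2r cone_coord_le1.
  rewrite ler_norml.
  rewrite /x invfM (mulrCA _ 2^-1); move: (_ / M) => z /andP[z0 z1].
  by apply/andP; split; lra.
have x12 p : (x p < 1 / 2) = (cone_coord p i < c).
  by rewrite /x gtrDl pmulr_llt0 ?invr_gt0// subr_lt0.
exists (fun k p => poly_step k (x p)); split.
- move=> k; eexists; apply: cone_polyX.
  apply: (@cone_poly_eq _ (fun p => 1 + (-1) * x p ^+ (2 * k))).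
    by move=> p _; rewrite mulN1r.
  apply: cone_polyL; first exact: cone_poly_cst.
  apply: cone_polyX.
  apply: (@cone_poly_eq _ (fun p => (1 / 2 - c / (2 * M)) + (2 * M)^-1 * cone_coord p i)).
    by move=> p _; rewrite /x; ring.
  by apply: cone_polyL; [exact: cone_poly_cst|exact: cone_poly_coord].
- by move=> k p Vp; exact/poly_step01/x01.
- move=> p Vp; have := cvg_poly_step (x01 p Vp); rewrite x12.
  rewrite indicE (_ : (p \in _) = (cone_coord p i < c))//.
  by apply/idP/idP; rewrite inE.
Qed.

End ConePolynomials.

(** * Orthogonal components *)

Section Spectral.
Context {R : realType} {d : nat}.
Local Notation X := (d.-tuple R * R)%type.
Local Notation V := (@V0 R d).
Local Notation sigma := (@cone_measure R d).
Variable w : X -> R.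
Hypothesis hw : weight w.
Implicit Types (f g h : X -> R) (p q : X).

Local Notation L2 := (wL2 sigma V w).
Let mV : measurable V := measurable_V0.
Let w0 : forall p, V p -> 0 <= w p := hw.1.
Let iw : sigma.-integrable V (EFin \o w) := hw.2.

Lemma in_L2_wL2 f : in_L2 w f -> L2 f.
Proof.
move=> [mf nf]; split => //.
have mw : measurable_fun V w by apply/measurable_EFinP; case/integrableP: iw.
apply/integrableP; split.
  by apply/measurable_EFinP; apply: measurable_funM => //; exact: measurable_funX.
rewrite (_ : integral _ _ _ = \int[sigma]_(p in V) (f p ^+ 2 * w p)%:E)%E; last first.
  apply: eq_integral => p /set_mem Vp /=; rewrite ger0_norm// mulr_ge0 ?sqr_ge0//.
  exact: w0.
move: nf; rewrite /L2norm; case: (integral _ _ _) => [r _||_].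
- exact: ltry.
- by rewrite poweRyr// invr_eq0.
- by [].
Qed.

Lemma L2normE f : L2 f -> L2norm w f = (Num.sqrt (inner w f f))%:E.
Proof.
move=> [mf jf]; have h0 := wdot_ge0 sigma w0 f.
rewrite -powR12_sqrt// -poweR_EFin /L2norm; congr (_ `^ _)%E.
rewrite /inner /Rintegral.
rewrite (@eq_integral _ _ _ sigma V (EFin \o (fun p => f p ^+ 2 * w p))).
  by rewrite fineK// integrable_fin_num.
by move=> p _ /=; rewrite expr2.
Qed.

Lemma cone_poly_wL2 n f : cone_poly n f -> L2 f.
Proof. by move=> /cone_poly_bounded[mf [M fM]]; exact: wL2_bounded fM. Qed.

Lemma cone_poly_dense f : L2 f -> forall e, 0 < e -> exists n g,
  cone_poly n g /\ inner w (fun p => f p - g p) (fun p => f p - g p) < e.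
Proof.
move=> lf e e0; pose S : set (X -> R) := [set g | exists n, cone_poly n g].
have SL c g h : S g -> S h -> S (fun p => g p + c * h p).
  move=> [m mg] [n nh]; exists (maxn m n); apply: cone_polyL.
    exact: cone_poly_leq (leq_maxl _ _) mg.
  exact: cone_poly_leq (leq_maxr _ _) nh.
have SM g h : S g -> S h -> S (fun p => g p * h p).
  by move=> [m mg] [n nh]; exists (m + n)%N; exact: cone_polyM.
have S1 : S (fun=> 1) by exists 0; exact: cone_poly_cst.
have SS g : S g -> L2 g by move=> [n]; exact: cone_poly_wL2.
have GS (E : set X) : cone_halfspace E -> measurable E /\ exists s_ : nat -> X -> R,
    [/\ forall n, S (s_ n), forall n x, V x -> 0 <= s_ n x <= 1 &
        forall x, V x -> s_ n x @[n --> \oo] --> (\1_E x : R)].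
  move=> GE; split; [exact: measurable_cone_halfspace|exact: cone_halfspace_approx].
have [_ /(_ e e0)[g [n ng] fg]] := wL2_dense mV w0 iw S1 SL SM SS
  (@measurable_sub_cone_halfspace R d) GS lf.
by exists n, g.
Qed.

(** Projection on the span of the monomials. The relation [|x|^2 = t^2] makes them dependent on the
    cone once [n >= 2], which [wL2_projection] allows. *)
Lemma cone_poly_projection n f : L2 f -> exists2 g, cone_poly n g &
  forall h, cone_poly n h -> inner w (fun p => f p - g p) h = 0.
Proof.
move=> lf.
have [||||g [ng _ fg]] := @wL2_projection _ _ _ sigma V w mV w0 iw
  (cone_poly n : set (X -> R)) (mpoly.bmultinom d.+1 n.+1) (index_enum _)
  (fun m => cone_monomial m) _ _ _ _ f lf.
- exact: cone_poly_cst.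
- by move=> c g h; exact: cone_polyL.
- by move=> g; exact: cone_poly_wL2.
- by move=> m; exact: cone_monomial_poly.
exists g => // h nh; have [c hc] := cone_poly_span nh.
have lfg : L2 (fun p => f p - g p) by apply: wL2B => //; exact: cone_poly_wL2 ng.
have lm m : L2 (cone_monomial (n := n) m) by exact/cone_poly_wL2/cone_monomial_poly.
rewrite [LHS](@eq_wdot _ _ _ sigma V w _ (fun p => f p - g p) _
  (fun p => \sum_m c m * cone_monomial (n := n) m p))//.
rewrite wdot_sumr//; last by move=> m; exact: wL2Z.
by rewrite big1// => m _; rewrite wdotZr// fg ?mem_index_enum// mulr0.
Qed.

Variable P : nat -> X -> X -> R.
Hypothesis hP : forall k : nat, reproducing_kernel w k (P k).

Lemma kernel_poly k q : V q -> cone_poly k (P k ^~ q).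
Proof. by move=> Vq; have [/(_ q Vq)[]] := hP k. Qed.

Lemma kernel_wL2 k q : V q -> L2 (P k ^~ q).
Proof. by move=> Vq; apply/cone_poly_wL2/kernel_poly. Qed.

(** By reproduction both values are the inner product of [P k ^~ p] and [P k ^~ q]. *)
Lemma kernelC k p q : V p -> V q -> P k p q = P k q p.
Proof.
move=> Vp Vq; have [oP rP] := hP k.
rewrite -[LHS](rP (P k ^~ q))//; last exact: oP.
rewrite -[RHS](rP (P k ^~ p))//; last exact: oP.
exact: wdotC.
Qed.

(** A polynomial of degree 0 is constant, and reproducing the function 1 forces this constant times
    the total mass to be 1; in particular the mass is nonzero. *)
Lemma kernel0 p q : V p -> V q -> P 0 p q = (wmass w V)^-1.
Proof.
move=> Vp Vq; have [oP rP] := hP 0; have [[Q sQ PQ] _] := oP q Vq.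
have {}PQ u : V u -> P 0 u q = mpoly.mcoeff mpoly.mnm0 Q.
  by move=> Vu; rewrite PQ// (mpoly.msize1_polyC sQ) mpoly.mevalC mpoly.mcoeffC eqxx mulr1.
have := rP (fun=> 1) q.
rewrite /inner (@eq_Rintegral _ _ _ sigma V (fun u => P 0 p q * w u)); last first.
  by move=> u /set_mem Vu; rewrite mul1r !PQ.
rewrite RintegralZl// => h1.
have {}h1 : P 0 p q * wmass w V = 1.
  by apply: h1 => //; split => //; exact: cone_poly_cst.
have W0 : wmass w V != 0.
  by apply/eqP => W0; move: h1; rewrite W0 mulr0 => /eqP; rewrite eq_sym oner_eq0.
by apply: (mulIf W0); rewrite h1 mulVf.
Qed.

(** * Components of a fixed function, Bessel's inequality and Parseval's identity *)

Section Components.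
Variable f : X -> R.
Hypothesis lf : L2 f.

Definition component k q : R := inner w f (P k ^~ q).

(** [Q n] is the projection of [f] on degree at most [n]. The difference of [Q k] and its
    predecessor is orthogonal to lower degrees, so [P k] reproduces it, while [f - Q k] and the
    predecessor are orthogonal to [P k ^~ q]. *)
Lemma component_telescope : exists Q : nat -> X -> R,
  [/\ forall n, cone_poly n (Q n),
      forall n h, cone_poly n h -> inner w (fun p => f p - Q n p) h = 0 &
      forall k q, V q ->
        component k q = Q k q - (if k is k'.+1 then Q k' q else 0)].
Proof.
have /choice[Q HQ] : forall n, exists g, cone_poly n g /\
    forall h, cone_poly n h -> inner w (fun p => f p - g p) h = 0.
  by move=> n; have [g ? ?] := cone_poly_projection n lf; exists g.
have nQ n : cone_poly n (Q n) by have [] := HQ n.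
have oQ n h : cone_poly n h -> inner w (fun p => f p - Q n p) h = 0.
  by have [_] := HQ n; apply.
exists Q; split => // k q Vq.
(* The zero function serves as the predecessor of [Q 0]. *)
pose Q' := if k is k'.+1 then Q k' else fun=> 0.
have kQ' : cone_poly k Q'.
  rewrite /Q'; case: (k) => [|k']; first exact: cone_poly_cst.
  exact: cone_poly_leq (leqnSn _) (nQ k').
have lQ := cone_poly_wL2 (nQ k); have lQ' := cone_poly_wL2 kQ'.
have lP := kernel_wL2 k Vq.
have oQ' m h : (m < k)%N -> cone_poly m h -> inner w (fun p => f p - Q' p) h = 0.
  rewrite /Q'; case: (k) => // k'; rewrite ltnS => mk mh.
  by apply: oQ; exact: cone_poly_leq mk mh.
have [oP rP] := hP k.
have PQ' : inner w Q' (P k ^~ q) = 0.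
  rewrite [LHS]wdotC; move: (oP q Vq) => [_]; rewrite /Q'; case: (k) => [|k'] H.
    rewrite (@eq_wdot _ _ _ sigma V w _ (P 0 ^~ q) _ (fun x => 0 * 0))//.
      by rewrite wdotZr ?mul0r//; [exact: wL2_cst|exact: kernel_wL2].
    by move=> x _; rewrite mulr0.
  exact: H (ltnSn k') (nQ k').
have og : orth_poly w k (fun p => Q k p - Q' p).
  split; first by apply: cone_poly_eq (cone_polyL (-1) (nQ k) kQ') => p _; rewrite mulN1r.
  move=> m g mk mg; have lg := cone_poly_wL2 mg.
  have := oQ' m g mk mg; have := oQ k g (cone_poly_leq (ltnW mk) mg).
  rewrite ![inner _ (fun p => _) _]wdotBl// => h1 h2; lra.
have := rP _ q og Vq; have := oQ k _ (kernel_poly k Vq); move: PQ'.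
rewrite ![inner _ (fun p => _ - _) _]wdotBl// /component /inner /wdot => h1 h2 h3.
have -> : (if k is k'.+1 then Q k' q else 0) = Q' q by rewrite /Q'; case: (k).
by lra.
Qed.

Lemma component_orth k : orth_poly w k (component k).
Proof.
have [Q [nQ oQ cQ]] := component_telescope.
split.
  case: k => [|k].
    by apply: cone_poly_eq (nQ 0) => p /set_mem Vp; rewrite cQ// subr0.
  apply: cone_poly_eq (cone_polyL (-1) (nQ k.+1) (cone_poly_leq (leqnSn k) (nQ k))).
  by move=> p /set_mem Vp; rewrite cQ// mulN1r.
case: k => // k m g; rewrite ltnS => mk mg.
have lQ n := cone_poly_wL2 (nQ n).
have lg := cone_poly_wL2 mg.
rewrite [LHS](@eq_wdot _ _ _ sigma V w _ (fun p => Q k.+1 p - Q k p) _ g)//; last first.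
  by move=> p /set_mem Vp; rewrite cQ.
have := oQ k g (cone_poly_leq mk mg).
have := oQ k.+1 g (cone_poly_leq (leqW mk) mg).
rewrite ![inner _ _ _]wdotBl// wdotBl// => h1 h2; lra.
Qed.

Lemma component_poly k : cone_poly k (component k).
Proof. by have [] := component_orth k. Qed.

Lemma component_wL2 k : L2 (component k).
Proof. exact/cone_poly_wL2/component_poly. Qed.

(** The sum of the components telescopes to the projection [Q n]. *)
Lemma component_residual n h : cone_poly n h ->
  inner w (fun p => f p - \sum_(0 <= k < n.+1) component k p) h = 0.
Proof.
have [Q [nQ oQ cQ]] := component_telescope => nh.
rewrite -[RHS](oQ n h nh); apply: eq_wdot => // p /set_mem Vp; congr (_ - _).
elim: n {nh} => [|n ih]; first by rewrite big_nat1 cQ// subr0.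
by rewrite big_nat_recr//= ih cQ// addrC subrK.
Qed.

Lemma component_dot k l : k != l -> inner w (component k) (component l) = 0.
Proof.
wlog kl : k l / (k < l)%N => [H|_].
  rewrite neq_ltn => /orP[kl|lk]; first by apply: H => //; rewrite ltn_eqF.
  by rewrite [LHS]wdotC; apply: H => //; rewrite ltn_eqF.
by rewrite [LHS]wdotC; apply: (component_orth l).2 kl (component_poly k).
Qed.

(** For equal degrees this is reproduction; otherwise the factor of larger degree is orthogonal to
    the one of smaller degree. *)
Lemma component_kernel k l q : V q ->
  inner w (component l) (P k ^~ q) = (k == l)%:R * component k q.
Proof.
move=> Vq; have [oP rP] := hP k.
have [<-|] := eqVneq k l; first by rewrite mul1r rP//; exact: component_orth.
rewrite neq_ltn mul0r => /orP[kl|lk].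
  exact: (component_orth l).2 kl (kernel_poly k Vq).
by rewrite [LHS]wdotC; apply: (oP q Vq).2 lk (component_poly l).
Qed.

Definition energy k : R := inner w (component k) (component k).

Lemma energy_ge0 k : 0 <= energy k.
Proof. exact: wdot_ge0. Qed.

(** Up to a residual orthogonal to degree [k], [f] is the sum of its components up to [k], of which
    only the last contributes. *)
Lemma component_dotl k : inner w f (component k) = energy k.
Proof.
have lk := component_wL2 k.
have ls : L2 (fun p => \sum_(0 <= l < k.+1) component l p).
  by apply: wL2_sum => // l; exact: component_wL2.
have := component_residual (component_poly k).
rewrite [inner _ _ _]wdotBl// => /eqP; rewrite subr_eq0 => /eqP fk.
rewrite [LHS]fk.
rewrite wdot_suml//; last by move=> l; exact: component_wL2.
rewrite big_nat_recr//= big_nat big1 ?add0r// => l /= lk'.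
by apply: component_dot; rewrite ltn_eqF.
Qed.

(** A multiplier acting on the orthogonal expansion of [f]; single frame levels and partial frame
    sums both take this form. *)
Definition filtered (c : nat -> R) n p : R := \sum_(0 <= k < n) c k * component k p.

Lemma filtered_wL2 c n : L2 (filtered c n).
Proof. by apply: wL2_sum => // k; apply: wL2Z => //; exact: component_wL2. Qed.

Lemma filtered_poly c n : cone_poly n (filtered c n.+1).
Proof.
rewrite /filtered.
apply: (@cone_poly_eq _ _ _ (fun p => \sum_(i < n.+1) c i * component i p)).
  by move=> p _; rewrite big_mkord.
apply: cone_poly_sum => i.
apply: (@cone_poly_eq _ _ _ (fun p => 0 + c i * component i p)).
  by move=> p _; rewrite add0r.
apply: cone_polyL; first exact: cone_poly_cst.
by apply: cone_poly_leq (component_poly i); rewrite -ltnS.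
Qed.

Lemma filtered_dot c b n : inner w (filtered c n) (filtered b n) =
  \sum_(0 <= k < n) c k * b k * energy k.
Proof.
have lk := component_wL2; have lZ e k : L2 (fun p => e * component k p) by exact: wL2Z.
rewrite [LHS]wdot_suml//; last exact: filtered_wL2.
rewrite big_nat [RHS]big_nat; apply: eq_bigr => k /= kn.
rewrite wdotZl//; last exact: filtered_wL2.
rewrite wdot_sumr// -mulrA; congr (_ * _).
rewrite (bigD1_seq k)/= ?mem_index_iota ?iota_uniq//.
rewrite wdotZr// big1 ?addr0// => l lk'.
by rewrite wdotZr// [X in _ * X]component_dot ?mulr0// eq_sym.
Qed.

Lemma filtered_dotl c n :
  inner w f (filtered c n) = \sum_(0 <= k < n) c k * energy k.
Proof.
have lk := component_wL2.
rewrite [LHS]wdot_sumr//; last by move=> k; exact: wL2Z.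
by apply: eq_bigr => k _; rewrite wdotZr// [X in _ * X]component_dotl.
Qed.

(** Expansion of the square, where [<f, f_k>] and [<f_k, f_k>] both equal [energy k]. The
    coefficient [2 c - c^2] is [1 - (1 - c)^2]. *)
Lemma filtered_residual c n :
  inner w (fun p => f p - filtered c n p) (fun p => f p - filtered c n p) =
  inner w f f - \sum_(0 <= k < n) (2 * c k - c k ^+ 2) * energy k.
Proof.
have lF := filtered_wL2 c n.
rewrite [LHS]wdotBl//; last exact: wL2B.
rewrite !wdotBr// (wdotC _ _ _ (filtered c n) f).
rewrite (filtered_dotl c n : wdot _ _ _ _ _ = _).
rewrite (filtered_dot c c n : wdot _ _ _ _ _ = _).
have -> : \sum_(0 <= k < n) (2 * c k - c k ^+ 2) * energy k =
    2 * \sum_(0 <= k < n) c k * energy k - \sum_(0 <= k < n) c k * c k * energy k.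
  rewrite mulr_sumr -sumrB; apply: eq_bigr => k _; ring.
rewrite /inner /wdot; lra.
Qed.

Lemma bessel n : \sum_(0 <= k < n) energy k <= inner w f f.
Proof.
have := wdot_ge0 sigma w0 (fun p => f p - filtered (fun=> 1) n p).
rewrite [wdot _ _ _ _ _]filtered_residual subr_ge0.
by under eq_bigr do rewrite expr1n mulr1 -[2]natr1 addrK mul1r.
Qed.

(** The partial sum is the projection [Q], so [f - Q] is orthogonal to [Q - g]; by Pythagoras [Q] is
    at least as close to [f] as the polynomial [g] given by density. *)
Lemma parseval_lt e : 0 < e ->
  exists n, inner w f f - \sum_(0 <= k < n.+1) energy k < e.
Proof.
move=> e0; have [n [g [ng fg]]] := cone_poly_dense lf e0.
exists n; apply: le_lt_trans fg.
have -> : inner w f f - \sum_(0 <= k < n.+1) energy k =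
    inner w (fun p => f p - filtered (fun=> 1) n.+1 p)
            (fun p => f p - filtered (fun=> 1) n.+1 p).
  rewrite filtered_residual; congr (_ - _); apply: eq_bigr => k _.
  by rewrite expr1n mulr1 -[2]natr1 addrK mul1r.
set Q := filtered _ _; have nQ : cone_poly n Q by exact: filtered_poly.
have lQ := cone_poly_wL2 nQ; have lg := cone_poly_wL2 ng.
have oQ h : cone_poly n h -> inner w (fun p => f p - Q p) h = 0.
  move=> nh; rewrite -[RHS](component_residual nh); apply: eq_wdot => // p _.
  by congr (_ - _); apply: eq_bigr => k _; rewrite mul1r.
have lfQ : L2 (fun p => f p - Q p) by exact: wL2B.
have lQg : L2 (fun p => Q p - g p) by exact: wL2B.
have nQg : cone_poly n (fun p => Q p - g p).
  by apply: cone_poly_eq (cone_polyL (-1) nQ ng) => p _; rewrite mulN1r.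
rewrite [leRHS](@eq_wdot _ _ _ sigma V w _ (fun p => (f p - Q p) + (Q p - g p)) _
   (fun p => (f p - Q p) + (Q p - g p))); [|by move=> p _; ring..].
rewrite (wdot_sqrD mV w0 iw lfQ lQg) (oQ _ nQg : wdot _ _ _ _ _ = _) mulr0 addr0 lerDl.
exact: wdot_ge0.
Qed.

End Components.

End Spectral.

(** * The frame *)

Section Frequencies.
Context {R : realType} (a : R -> R).
Hypothesis ha : admissible_cutoff a.

Let a_supp (t : R) : ~ (1 / 2 <= t <= 2) -> a t = 0.
Proof.
move=> nt; have [_ _ sa _ _] := ha; apply/eqP/negPn/negP => at0; apply: nt.
by have /sa /= := @subset_closure _ [set t | a t != 0] t at0; rewrite in_itv.
Qed.

(** The support may contain the endpoint 2, but by continuity a nonzero value there would persist at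
    some [2 + e / 2], outside the support. Hence level [j] sees only degrees strictly below
    [2^j]. *)
Let a2 : a 2 = 0.
Proof.
apply/eqP/negPn/negP => a20; have [_ da _ _ _] := ha.
have ca : {for 2, continuous a}.
  by apply: differentiable_continuous; apply/derivable1_diffP; exact: (da 0 2).
have : \forall t \near (2 : R), a t != 0.
  exact: (cvgr_neq0 (a 2) ca a20).
move=> /nbhs_ballP[e /= e0 /(_ (2 + e / 2))].
rewrite /ball /= opprD addNKr normrN ger0_norm ?divr_ge0 ?ltW//.
rewrite ltr_pdivrMr// ltr_pMr// ltr1n => /(_ isT)/negP; apply; apply/eqP.
by apply: a_supp => /andP[_]; lra.
Qed.

(** The value c_j(k) with which level [j] weights degree [k]; level 0 keeps the constants only. *)
Definition frequency (j k : nat) : R :=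
  if j is i.+1 then a (k%:R / (2 ^ i)%:R) else (k == 0)%:R.

Lemma frequency_high j k : (2 ^ j <= k)%N -> frequency j k = 0.
Proof.
case: j => [|j]; first by case: k.
rewrite expnS -(ler_nat R) natrM => jk.
have p0 : 0 < (2 ^ j)%:R :> R by rewrite ltr0n expn_gt0.
have : 2 <= k%:R / (2 ^ j)%:R :> R by rewrite ler_pdivlMr.
rewrite /= le_eqVlt => /predU1P[<-//|k2].
by apply: a_supp => /andP[_]; rewrite leNgt k2.
Qed.

(** At such levels the argument of [a] is below [2^n / 2^(n+1) = 1 / 2], the lower end of the
    support. *)
Lemma frequency_low j k n : (k < 2 ^ n)%N -> (n.+2 <= j)%N -> frequency j k = 0.
Proof.
case: j => // j kn; rewrite ltnS => nj.
have p0 : 0 < (2 ^ j)%:R :> R by rewrite ltr0n expn_gt0.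
apply: a_supp => /andP[+ _]; rewrite leNgt => /negP; apply.
rewrite ltr_pdivrMr// mulrC mul1r ltr_pdivlMr// -natrM ltr_nat.
apply: (@leq_trans (2 ^ n.+1)); last by rewrite leq_exp2l.
by rewrite expnSr ltn_pmul2r.
Qed.

Definition frequency_sum n k : R := \sum_(0 <= j < n) frequency j k ^+ 2.

(** If [2^l <= k < 2^(l+1)], only levels [l + 1] and [l + 2] see [k]. Their arguments are [2 t] and
    [t] with [t = k / 2^(l+1)] in [[1/2, 1]], so the two squares add up to 1. *)
Lemma frequency_sum_eq1 n m k : (k < 2 ^ n)%N -> (n.+2 <= m)%N ->
  frequency_sum m k = 1.
Proof.
move=> kn nm.
have tail l u v : (k < 2 ^ l)%N -> (l.+2 <= u)%N -> (u <= v)%N ->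
    frequency_sum v k = frequency_sum u k.
  move=> kl lu uv; rewrite /frequency_sum (big_cat_nat (leq0n u) uv)//=.
  rewrite [X in _ + X]big_nat [X in _ + X]big1 ?addr0// => j /andP[uj _].
  by rewrite (frequency_low kl (leq_trans lu uj)) expr0n.
(* Degree 0 is carried by level 0 alone, as [a 0 = 0]. *)
have [k0|k0] := posnP k.
  rewrite k0 in kn tail *; rewrite (tail 0 2 m)//; last exact: leq_trans nm.
  rewrite /frequency_sum !big_nat_recr//= big_nil mul0r a_supp.
    by rewrite expr1n expr0n/= addr0 add0r.
  by move=> /andP[]; lra.
have [l /andP[lk kl]] : exists l, (2 ^ l <= k < 2 ^ l.+1)%N.
  by exists (trunc_log 2 k); exact: trunc_log_bounds.
have ln : (l < n)%N by rewrite -(@ltn_exp2l 2)// (leq_ltn_trans lk).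
rewrite (tail l.+1 l.+3 m)//; last exact: leq_trans (ln : l.+3 <= n.+2)%N nm.
rewrite /frequency_sum big_nat_recr// big_nat_recr//= big_nat big1 ?add0r; last first.
  move=> j /andP[_ jl]; rewrite frequency_high ?expr0n//.
  by rewrite (leq_trans _ lk)// leq_exp2l.
have [_ _ _ _ /(_ (k%:R / (2 ^ l.+1)%:R))] := ha.
have p0 : 0 < (2 ^ l)%:R :> R by rewrite ltr0n expn_gt0.
have -> : 2 * (k%:R / (2 ^ l.+1)%:R) = k%:R / (2 ^ l)%:R :> R.
  by rewrite expnS natrM; field; rewrite gt_eqF.
rewrite addrC; apply; rewrite expnS natrM.
apply/andP; split.
  by rewrite ler_pdivlMr ?mulr_gt0// mulrA divfK// mul1r ler_nat.
by rewrite ler_pdivrMr ?mulr_gt0// mul1r -natrM -expnS ler_nat ltnW.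
Qed.

(** The terms are squares, and adding further levels brings the sum to 1; [k < 2^k] tells how many
    suffice. *)
Lemma frequency_sum01 n k : 0 <= frequency_sum n k <= 1.
Proof.
have F0 j : 0 <= frequency j k ^+ 2 by rewrite sqr_ge0.
rewrite {1}/frequency_sum sumr_ge0//=.
have <- : frequency_sum (maxn k.+2 n) k = 1.
  by apply: (@frequency_sum_eq1 k); [exact: ltn_expl|exact: leq_maxl].
rewrite /frequency_sum (big_cat_nat (leq0n n) (leq_maxr k.+2 n))/= lerDl.
by rewrite sumr_ge0.
Qed.

End Frequencies.

(** * From quadrature sums over the nodes to filtered expansions *)

Section FrameSums.
Context {R : realType} {d : nat}.
Local Notation X := (d.-tuple R * R)%type.
Local Notation V := (@V0 R d).
Local Notation sigma := (@cone_measure R d).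
Variables (w : X -> R) (P : nat -> X -> X -> R) (a : R -> R).
Variables (Xi : nat -> set X) (lam : nat -> X -> R).
Hypothesis hw : weight w.
Hypothesis hP : forall k : nat, reproducing_kernel w k (P k).
Hypothesis ha : admissible_cutoff a.
Hypothesis XiV : forall j, Xi j `<=` V.
Hypothesis hlam : frame_quadrature w Xi lam.
Variable f : X -> R.
Hypothesis lf : wL2 sigma V w f.
Local Notation psi := (frame_element w a P lam).
Local Notation freq := (frequency a).
Let mV : measurable V := measurable_V0.
Let w0 : forall p, V p -> 0 <= w p := hw.1.
Let iw : sigma.-integrable V (EFin \o w) := hw.2.

Lemma frame_kernelE j p q : V p -> V q ->
  frame_kernel w a P j p q = \sum_(0 <= k < (2 ^ j).+1) freq j k * P k p q.
Proof.
(* At level 0 the range [k < 2] has a second term, with coefficient 0; the first is the constant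
   kernel [P 0]. *)
move=> Vp Vq; case: j => [|j].
  by rewrite expn0 big_nat_recr//= big_nat1 /= mul1r mul0r addr0 (kernel0 hw hP).
by rewrite /= /cutoff_kernel expnS.
Qed.

Lemma frame_kernelC j p q : V p -> V q ->
  frame_kernel w a P j p q = frame_kernel w a P j q p.
Proof.
move=> Vp Vq; rewrite !frame_kernelE//.
by apply: eq_bigr => k _; rewrite (kernelC hP).
Qed.

Lemma frame_kernel_poly j q : V q -> cone_poly (2 ^ j) (frame_kernel w a P j ^~ q).
Proof.
move=> Vq.
apply: (@cone_poly_eq _ _ _ (fun p => \sum_(k < (2 ^ j).+1) (0 + freq j k * P k p q))).
  move=> p /set_mem Vp; rewrite frame_kernelE// big_mkord.
  by apply: eq_bigr => k _; rewrite add0r.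
apply: cone_poly_sum => k; apply: cone_polyL; first exact: cone_poly_cst.
by apply: cone_poly_leq (kernel_poly hP k Vq); rewrite -ltnS.
Qed.

Local Notation cmp := (component w P f).
Local Notation level j := (filtered w P f (freq j) (2 ^ j).+1).

Lemma frame_coefficient j z : Xi j z ->
  inner w f (psi j z) = Num.sqrt (lam j z) * level j z.
Proof.
move=> /XiV Vz; have lP k := kernel_wL2 hw hP k Vz.
have lZ k : wL2 sigma V w (fun p => freq j k * P k p z) by exact: wL2Z.
rewrite [LHS](@eq_wdot _ _ _ sigma V w _ f _ (fun p => Num.sqrt (lam j z) *
  \sum_(0 <= k < (2 ^ j).+1) freq j k * P k p z))//; last first.
  by move=> p /set_mem Vp; rewrite /frame_element frame_kernelE.
rewrite wdotZr//; last exact: wL2_sum.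
rewrite wdot_sumr//; congr (_ * _); apply: eq_bigr => k _.
by rewrite wdotZr.
Qed.

Lemma level_wL2 j : wL2 sigma V w (level j).
Proof. exact: filtered_wL2. Qed.

Lemma level_poly j : cone_poly (2 ^ j) (level j).
Proof. exact: filtered_poly. Qed.

(** The product has degree at most [2 * 2^j = 2^(j+1)], within the exactness of the quadrature. *)
Lemma frame_quadratureM j (g h : X -> R) :
  cone_poly (2 ^ j) g -> cone_poly (2 ^ j) h ->
  \sum_(z \in Xi j) lam j z * (g z * h z) = inner w g h.
Proof.
move=> jg jh; have [_ quad _] := hlam.
by rewrite -(quad j (fun p => g p * h p))// expnS mul2n -addnn; exact: cone_polyM.
Qed.

(** Squaring [Num.sqrt (lam j z)] yields the quadrature weight, so the sum is the integral of the
    squared polynomial [level j]. *)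
Lemma frame_level_energy j :
  \sum_(z \in Xi j) `|inner w f (psi j z)| ^+ 2 =
  \sum_(0 <= k < (2 ^ j).+1) freq j k ^+ 2 * energy w P f k.
Proof.
under eq_bigr do rewrite expr2.
rewrite -(filtered_dot hw hP lf) -(frame_quadratureM (level_poly j) (level_poly j)).
apply: eq_fsbigr => z /set_mem Xz; have [lam0 _ _] := hlam.
rewrite frame_coefficient// real_normK ?num_real// exprMn sqr_sqrtr ?expr2//.
exact/ltW/lam0.
Qed.

Lemma frame_level_sum j p : V p ->
  \sum_(z \in Xi j) inner w f (psi j z) * psi j z p =
  \sum_(0 <= k < (2 ^ j).+1) freq j k ^+ 2 * component w P f k p.
Proof.
move=> Vp; have lP k := kernel_wL2 hw hP k Vp.
have lZ k : wL2 sigma V w (fun q => freq j k * P k q p) by exact: wL2Z.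
(* The two square roots combine to the quadrature weight and the kernel is symmetric, so the sum
   over nodes integrates a product of two polynomials of degree at most [2^j]. *)
transitivity (inner w (level j) (frame_kernel w a P j ^~ p)).
  rewrite -(frame_quadratureM (level_poly j) (frame_kernel_poly j Vp)).
  apply: eq_fsbigr => z /set_mem Xz; have [lam0 _ _] := hlam.
  rewrite frame_coefficient// /frame_element (frame_kernelC j Vp (XiV Xz)).
  by rewrite mulrACA -expr2 sqr_sqrtr//; exact/ltW/lam0.
rewrite [LHS](@eq_wdot _ _ _ sigma V w _ (level j) _
  (fun q => \sum_(0 <= k < (2 ^ j).+1) freq j k * P k q p))//; last first.
  by move=> q /set_mem Vq; rewrite frame_kernelE.
have lc l : wL2 sigma V w (fun q => freq j l * cmp l q).
  by apply: wL2Z => //; exact: component_wL2.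
rewrite wdot_sumr//; last exact: level_wL2.
rewrite big_nat [RHS]big_nat; apply: eq_bigr => k /= kj.
rewrite wdotZr//; last exact: level_wL2.
rewrite wdot_suml// expr2 -mulrA; congr (_ * _).
(* Only the diagonal term [l = k] survives, which produces the square of [freq j k]. *)
rewrite (eq_bigr (fun l => freq j l * ((k == l)%:R * cmp k p))); last first.
  move=> l _; rewrite wdotZl//; last exact: component_wL2.
  by congr (_ * _); exact: component_kernel.
rewrite (bigD1_seq k) ?mem_index_iota ?iota_uniq// eqxx mul1r big1 /= ?addr0//.
by move=> l lk; rewrite eq_sym (negbTE lk) mul0r mulr0.
Qed.

(** Level [j < n] stops at degree [2^j < 2^n], so each inner sum can be padded with vanishing terms
    to a common range before exchanging the sums. *)
Lemma sum_frequency_levels n (F : nat -> R) :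
  \sum_(0 <= j < n) \sum_(0 <= k < (2 ^ j).+1) freq j k ^+ 2 * F k =
  \sum_(0 <= k < 2 ^ n) frequency_sum a n k * F k.
Proof.
under [RHS]eq_bigr do rewrite mulr_suml.
rewrite exchange_big/= big_nat [RHS]big_nat; apply: eq_bigr => j /andP[_ jn].
have jn2 : ((2 ^ j).+1 <= 2 ^ n)%N by rewrite ltn_exp2l.
rewrite (big_cat_nat (leq0n _) jn2)/= [X in _ = _ + X]big_nat.
rewrite [X in _ = _ + X]big1 ?addr0// => k /andP[jk _].
by rewrite (frequency_high ha (ltnW jk)) expr0n mul0r.
Qed.

Lemma frame_partial_sum n p : V p ->
  \sum_(0 <= j < n) \sum_(z \in Xi j) inner w f (psi j z) * psi j z p =
  filtered w P f (frequency_sum a n) (2 ^ n) p.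
Proof.
move=> Vp; apply: etrans (sum_frequency_levels n (fun k => cmp k p)).
by apply: eq_bigr => j _; exact: frame_level_sum.
Qed.

Lemma frame_partial_energy n :
  \sum_(0 <= j < n) \sum_(z \in Xi j) `|inner w f (psi j z)| ^+ 2 =
  \sum_(0 <= k < 2 ^ n) frequency_sum a n k * energy w P f k.
Proof.
apply: etrans (sum_frequency_levels n (energy w P f)).
by apply: eq_bigr => j _; exact: frame_level_energy.
Qed.

(* Squeezed between the partial sums of the energy and Bessel's bound. *)
Lemma weighted_energy_cvg (c : nat -> nat -> R) :
  (forall n k, 0 <= c n k <= 1) ->
  (forall n m k, (k < 2 ^ n)%N -> (n.+2 <= m)%N -> c m k = 1) ->
  \sum_(0 <= k < 2 ^ n) c n k * energy w P f k @[n --> \oo] --> inner w f f.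
Proof.
move=> c01 c1; have E0 k := energy_ge0 hw P f k.
apply/cvgrPdist_lt => e /(parseval_lt hw hP lf)[n ne].
near=> m.
have nm : (n.+2 <= m)%N by near: m; exists n.+2.
have n2 : (n.+1 <= 2 ^ n)%N by exact: ltn_expl.
have nm2 : (n.+1 <= 2 ^ m)%N.
  by rewrite (leq_trans n2)// leq_exp2l// ltnW// ltnW.
have up : \sum_(0 <= k < 2 ^ m) c m k * energy w P f k <= inner w f f.
  apply: le_trans (bessel hw hP lf (2 ^ m)); apply: ler_sum => k _.
  by have /andP[_ ?] := c01 m k; rewrite ler_piMl.
have lo : \sum_(0 <= k < n.+1) energy w P f k <=
    \sum_(0 <= k < 2 ^ m) c m k * energy w P f k.
  rewrite (big_cat_nat (leq0n _) nm2)/= -[leLHS]addr0 lerD//.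
    rewrite big_nat [leRHS]big_nat; apply: ler_sum => k /= kn.
    by rewrite (c1 n)// ?mul1r// (leq_trans kn).
  by apply: sumr_ge0 => k _; have /andP[? _] := c01 m k; rewrite mulr_ge0.
by rewrite ger0_norm ?subr_ge0//; lra.
Unshelve. all: by end_near. Qed.

Lemma frame_energy_cvg :
  \sum_(0 <= j < n) \sum_(z \in Xi j) `|inner w f (psi j z)| ^+ 2
    @[n --> \oo] --> inner w f f.
Proof.
under eq_fun do rewrite frame_partial_energy.
apply: weighted_energy_cvg => [n k|n m k]; first exact: frequency_sum01.
exact: frequency_sum_eq1.
Qed.

(** The residual is [|f|^2] minus an energy sum with weights [2 c - c^2]. These again lie in
    [[0, 1]] and become 1 where [c] does, so the weighted sum tends to [|f|^2]. *)
Lemma frame_residual_cvg :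
  inner w (fun p => f p - filtered w P f (frequency_sum a n) (2 ^ n) p)
          (fun p => f p - filtered w P f (frequency_sum a n) (2 ^ n) p)
    @[n --> \oo] --> 0.
Proof.
under eq_fun do rewrite (filtered_residual hw hP lf).
set r := (X in X @ _).
suff : r n @[n --> \oo] --> inner w f f - inner w f f by rewrite subrr.
apply: cvgB; first exact: cvg_cst.
apply: (@weighted_energy_cvg
  (fun n k => 2 * frequency_sum a n k - frequency_sum a n k ^+ 2)) => [n k|n m k kn nm].
  by have /andP[] := frequency_sum01 ha n k; nra.
by rewrite (frequency_sum_eq1 ha kn nm) expr1n; lra.
Qed.

End FrameSums.

(** * Frame expansion and norm identity *)

Theorem theorem4p22 (R : realType) (d : nat) (hd : (2 <= d)%N)
    (w : d.-tuple R * R -> R) (hw : doubling_weight w)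
    (P : nat -> d.-tuple R * R -> d.-tuple R * R -> R)
    (hP : forall k : nat, reproducing_kernel w k (P k))
    (a : R -> R) (ha : admissible_cutoff a)
    (cd : R) (hcd : 1 < cd) (delta : R) (hdelta : 0 < delta)
    (Xi : nat -> set (d.-tuple R * R))
    (hXi : forall j : nat, maximal_separated cd (delta / 2 ^+ j) (Xi j))
    (lam : nat -> d.-tuple R * R -> R) (hlam : frame_quadrature w Xi lam)
    (f : d.-tuple R * R -> R) (hf : in_L2 w f) :
  let psi := frame_element w a P lam in
  (L2norm w (fun p => f p -
      \sum_(0 <= j < n) \sum_(z \in Xi j) inner w f (psi j z) * psi j z p)
     @[n --> \oo] --> 0%E) /\
  L2norm w f =
    ((\sum_(0 <= j <oo) (\sum_(z \in Xi j) `|inner w f (psi j z)| ^+ 2)%:E)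
       `^ 2^-1)%E.
Proof.
move=> psi; have [w_weight _] := hw; have lf := in_L2_wL2 w_weight hf.
have XiV j : Xi j `<=` @V0 R d by have [[]] := hXi j.
split.
  (* [T n] agrees on the cone with the partial frame sum over levels below [n]. *)
  pose T n := filtered w P f (frequency_sum a n) (2 ^ n).
  have lT n : wL2 (@cone_measure R d) (@V0 R d) w (fun p => f p - T n p).
    exact: (wL2B measurable_V0 w_weight.1 w_weight.2 lf (filtered_wL2 w_weight hP lf _ _)).
  rewrite (_ : (fun n => _) = fun n =>
      (Num.sqrt (inner w (fun p => f p - T n p) (fun p => f p - T n p)))%:E).
    apply: cvg_EFin; first exact: nearW.
    (* The squared residual tends to 0, and the square root is continuous there. *)
    have := cvg_comp _ _ (frame_residual_cvg w_weight hP ha lf) (@sqrt_continuous R 0).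
    by rewrite sqrtr0.
  (* The two functions agree only on the cone, so the replacement is made under the integral. *)
  apply/funext => n; rewrite -(L2normE w_weight (lT n)) /L2norm.
  congr (_ `^ _)%E; apply: eq_integral => p /set_mem Vp.
  by rewrite (frame_partial_sum w_weight hP ha XiV hlam lf).
have -> : (\sum_(0 <= j <oo) (\sum_(z \in Xi j) `|inner w f (psi j z)| ^+ 2)%:E)%E =
    (inner w f f)%:E.
  apply: cvg_lim => //; under eq_fun do rewrite sumEFin.
  by apply: cvg_EFin; [exact: nearW|exact: frame_energy_cvg].
rewrite (L2normE w_weight lf) poweR_EFin powR12_sqrt//.
by apply: wdot_ge0; exact: w_weight.1.
Qed.
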